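(* Let $m\ge 2$ and suppose that the antisymmetric matrix $\Lambda\in\mathbb{R}^{m\times m}$ is non-zero. Consider the equation $$\int_{B} D\gamma(\nabla u)\cdot\nabla\varphi-\Lambda u_{,\tau}\cdot\frac{\varphi}{R}\,dx=0\quad\text{for all }\varphi\in C_c^\infty(B,\mathbb{R}^m).\qquad(\ast)$$ (a) There exist one-homogeneous solutions $u(R,\theta)=Rg(\theta)$ of $(\ast)$ such that $g$ obeys the conservation law $|g|^2+|g'|^2=c^2$ for some constant $c$, and such that: (i) $u$ is linear, if $m$ is an odd integer, or if $m$ is even and $\Lambda$ has a non-trivial kernel; (ii) $u$ is non-linear and the set $u(B)$ is homeomorphic to a two-dimensional disk in $\mathbb{R}^m$ covered $k$ times, where $k\in\mathbb{N}\setminus\{1\}$, provided $f$ is such that $$\left(\frac{(k^2-1)f'(t)}{kt}\right)^2$$ lies in the (non-zero) spectrum of $-\Lambda^2$ for some $t>0$. (b) Let $f$ belong to $C^2(\mathbb{R}^+,\mathbb{R})$ and suppose that $f''(t)>0$ for all $t>0$ and $f'(0+)\ge 0$. Then any one-homogeneous solution $u=Rg$ of $(\ast)$ such that $g$ is of class $C^2(\mathbb{S}^1,\mathbb{R}^m)$ satisfies the conservation law $|g|^2+|g'|^2=c^2$ for some constant $c$. In particular, $g$ satisfies $$\frac{f'(c)}{c}(g''+g)+\Lambda g'=0\quad\text{on }[0,2\pi].$$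
   Context: $B$ is the open unit ball centred at $0$ in $\mathbb{R}^2$; $(R,\theta)$ are plane polar coordinates, $R=|x|$; $u_{,\tau}=\frac1R u_{,\theta}$, where $u_{,\theta}$ is the partial derivative with respect to $\theta$. With $e_R(\theta)=(\cos\theta,\sin\theta)^T$ and $e_\theta(\theta)=(-\sin\theta,\cos\theta)^T$, $\nabla u=u_{,R}\otimes e_R(\theta)+u_{,\tau}\otimes e_\theta(\theta)$. The inner product of matrices is $F_1\cdot F_2=\mathrm{tr}(F_1^TF_2)$ and $|F|^2=F\cdot F$. The function $f:[0,\infty)\to\mathbb{R}$ is differentiable on $\mathbb{R}^+=(0,\infty)$, and $\gamma(F)=f(|F|)$ for $F\in\mathbb{R}^{m\times 2}$, so $D\gamma(F)=f'(|F|)F/|F|$ for $F\ne0$. Convention: $f'(s)/s$ is read as $0$ when $s=0$, i.e. $D\gamma(\nabla u)$ is taken to be $0$ where $\nabla u=0$. The matrix $\Lambda$ is built from real constants $\lambda_{ij}$, $1\le i<j\le m$: $\Lambda_{ij}=\lambda_{ij}$ if $i<j$, $\Lambda_{ii}=0$, $\Lambda_{ij}=-\lambda_{ji}$ if $i>j$. A one-homogeneous map $u$ satisfies $u(\lambda x)=\lambda u(x)$ for all $\lambda\ge0$; equivalently $u=Rg(\theta)$ with $g(\theta)=u(\cos\theta,\sin\theta)$ a $2\pi$-periodic function (taken Lipschitz). ''Covered $k$ times'' means that each non-zero point of $u(B)$ has exactly $k$ preimages in $B$. $\mathbb{N}=\{1,2,\dots\}$. *)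

(* Defs.v *)
From HB Require Import structures.
From mathcomp Require Import all_boot all_order all_algebra.
From mathcomp Require Import all_classical all_reals all_analysis.

Set Implicit Arguments.
Unset Strict Implicit.
Unset Printing Implicit Defensive.

Import Order.TTheory GRing.Theory Num.Theory.
Import numFieldNormedType.Exports.

Local Open Scope classical_set_scope.
Local Open Scope ring_scope.

Section Defs.
Context {R : realType}.

Definition mxdot {m n : nat} (F G : 'M[R]_(m, n)) : R := \tr (F^T *m G).

(* The norm `|F| of the library is the sup norm, hence this definition. *)
Definition enorm {m n : nat} (F : 'M[R]_(m, n)) : R := Num.sqrt (mxdot F F).

Definition gamma {m : nat} (f : R -> R) (F : 'M[R]_(m, 2)) : R := f (enorm F).

Definition Dgamma {m : nat} (f : R -> R) (F : 'M[R]_(m, 2)) : 'M[R]_(m, 2) :=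
  if F == 0 then 0
  else \matrix_(i < m, j < 2) 'D_(delta_mx i j) (gamma f) F.

(* The plane is R * R, which carries the product Lebesgue measure. *)
Definition rad (x : R * R) : R := Num.sqrt (x.1 ^+ 2 + x.2 ^+ 2).

Definition disk : set (R * R) := [set x | rad x < 1].

Local Notation mu2 := (@lebesgue_measure R \x @lebesgue_measure R)%E.

Definition colv (x : R * R) : 'cV[R]_2 :=
  \col_(i < 2) (if i == ord0 then x.1 else x.2).

Definition unitR (x : R * R) : R * R := (x.1 / rad x, x.2 / rad x).

Definition unitT (x : R * R) : R * R := (- x.2 / rad x, x.1 / rad x).

Definition rot (t : R) (x : R * R) : R * R :=
  (cos t * x.1 - sin t * x.2, sin t * x.1 + cos t * x.2).

(* Polar partial derivatives at x = rad x *: (cos theta, sin theta), written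
   without choosing theta: unitR x = (cos theta, sin theta), and
   rot t x = rad x *: (cos (theta + t), sin (theta + t)). *)
Definition dR {m : nat} (u : R * R -> 'cV[R]_m) (x : R * R) : 'cV[R]_m :=
  derive1 (fun r : R => u (r *: unitR x)) (rad x).

Definition dtheta {m : nat} (u : R * R -> 'cV[R]_m) (x : R * R) : 'cV[R]_m :=
  derive1 (fun t : R => u (rot t x)) 0.

Definition dtau {m : nat} (u : R * R -> 'cV[R]_m) (x : R * R) : 'cV[R]_m :=
  (rad x)^-1 *: dtheta u x.

Definition tensor {m n : nat} (a : 'cV[R]_m) (b : 'cV[R]_n) : 'M[R]_(m, n) :=
  a *m b^T.

(* For a Lipschitz u the derivatives exist almost everywhere and agree with the
   weak ones; the junk values elsewhere do not matter under the integral. *)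
Definition grad {m : nat} (u : R * R -> 'cV[R]_m) (x : R * R) : 'M[R]_(m, 2) :=
  tensor (dR u x) (colv (unitR x)) + tensor (dtau u x) (colv (unitT x)).

Fixpoint Ck {m : nat} (k : nat) (phi : R * R -> 'cV[R]_m) : Prop :=
  if k is k'.+1 then
    [/\ forall x, differentiable phi x,
        Ck k' (fun x => 'D_((1, 0) : R * R) phi x) &
        Ck k' (fun x => 'D_((0, 1) : R * R) phi x)]
  else continuous phi.

(* C_c^oo(B, R^m), its elements being extended by 0 to the whole plane *)
Definition test_function {m : nat} (phi : R * R -> 'cV[R]_m) : Prop :=
  [/\ forall k, Ck k phi,
      compact (closure [set x | phi x != 0]) &
      closure [set x | phi x != 0] `<=` disk].

Definition weak_integrand {m : nat} (f : R -> R) (Lambda : 'M[R]_m)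
    (u phi : R * R -> 'cV[R]_m) (x : R * R) : R :=
  mxdot (Dgamma f (grad u x)) (grad phi x)
  - mxdot (Lambda *m dtau u x) ((rad x)^-1 *: phi x).

(* Integrability is required explicitly because the library integral is total. *)
Definition weak_solution {m : nat} (f : R -> R) (Lambda : 'M[R]_m)
    (u : R * R -> 'cV[R]_m) : Prop :=
  forall phi : R * R -> 'cV[R]_m, test_function phi ->
    mu2.-integrable disk (EFin \o weak_integrand f Lambda u phi) /\
    (\int[mu2]_(x in disk) (weak_integrand f Lambda u phi x)%:E = 0)%E.

Definition profile {m : nat} (u : R * R -> 'cV[R]_m) (theta : R) : 'cV[R]_m :=
  u (cos theta, sin theta).

Definition one_homogeneous {m : nat} (u : R * R -> 'cV[R]_m) : Prop :=
  (forall (l : R) (x : R * R), 0 <= l -> u (l *: x) = l *: u x) /\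
  lipschitz (profile u).

Definition one_homogeneous_solution {m : nat} (f : R -> R) (Lambda : 'M[R]_m)
    (u : R * R -> 'cV[R]_m) : Prop :=
  one_homogeneous u /\ weak_solution f Lambda u.

(* Differentiability is stated since derive1 g is a total function; 0 <= c because
   c is the value of |grad u|, at which f' gets evaluated. *)
Definition conservation_law {m : nat} (g : R -> 'cV[R]_m) (c : R) : Prop :=
  [/\ 0 <= c,
      forall theta, derivable g theta 1 &
      forall theta, enorm (g theta) ^+ 2 + enorm (derive1 g theta) ^+ 2 = c ^+ 2].

Definition C2_on {V : normedModType R} (A : set R) (g : R -> V) : Prop :=
  forall t, A t ->
    [/\ derivable g t 1, derivable (derive1 g) t 1 & {for t, continuous (derive1n 2 g)}].

Definition homeomorphic {T U : topologicalType} (A : set T) (B : set U) : Prop :=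
  exists (h : T -> U) (h' : U -> T),
    [/\ {within A, continuous h}, {within B, continuous h'},
        h @` A = B, h' @` B = A & {in A, cancel h h'}].

Definition covered_times {m : nat} (u : R * R -> 'cV[R]_m) (k : nat) : Prop :=
  forall y, (u @` disk) y -> y != 0 -> (disk `&` u @^-1` [set y] #= `I_k)%card.

End Defs.

(* Main.v *)
Require Import Defs.
From HB Require Import structures.
From mathcomp Require Import all_boot all_order all_algebra.
From mathcomp Require Import all_classical all_reals all_analysis.
From mathcomp Require Import measurable_realfun ring lra.
Import Defs.

Set Implicit Arguments.
Unset Strict Implicit.
Unset Printing Implicit Defensive.

Import Order.TTheory GRing.Theory Num.Theory.
Import numFieldNormedType.Exports.

Local Open Scope classical_set_scope.
Local Open Scope ring_scope.

(** Polar coordinates turn the equation for [u = R g] into an ordinary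
    differential equation on the circle. With [h^2 = |g|^2 + |g'|^2], the norm of
    [grad u] is [h], which depends on the angle only; put [a = f'(h) / h]. The weak
    form reads: the integral of [a g . phi_R + a g' . phi_tau - Lambda g' . phi / R]
    is zero for every test function [phi]. The vector field with radial part
    [phi . a g] and angular part [phi . a g'] has divergence
    [a g . phi_R + a g' . phi_tau + phi . (a g + (a g')') / R] off the origin. Such
    divergences integrate to zero ([polar_divergence], [polar_form_integral]): in
    Cartesian coordinates each of their two terms is integrated along the lines
    that avoid the origin, and Fubini applies because [1 / R] is integrable. Hence,
    wherever [a] and [g'] are C1 functions of the angle, the weak equation amounts
    to [(a g')' + a g + Lambda g' = 0].

    Part (a). If [h] is a constant [t], this equation has constant coefficients
    and any C2 solution on the circle yields a weak solution
    ([weak_solution_of_ode]). A vector [v] in the kernel of [Lambda], which exists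
    when [m] is odd because then [det Lambda = 0], gives [g = cos(theta) v], that
    is a linear [u]. An eigenvector [v] of [- Lambda^2] with the prescribed
    eigenvalue gives [g = cos(k theta) v + sin(k theta) w], where [w] is the
    multiple of [Lambda v] with the length of [v] ([winding_solution_exists]). This
    [u] is the [k]-fold winding of the disk onto a disk of the plane spanned by
    [v] and [w], which gives its image, its fibers and its nonlinearity
    ([winding_homeomorphic], [winding_covered], [winding_nonlinear]).

    Part (b). The coefficient [a] may be singular where [grad u] vanishes, so the
    equation is derived only where [h > 0], by testing with bump functions
    supported near one direction ([residual_eq0]). There its scalar product with
    [g'] says that the derivative of [h^2] times a positive quantity is zero, by
    convexity of [f] and positivity of [f']; where [h = 0] the derivative of [h^2]
    vanishes as well. So [h] is constant ([conservation]). *)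

(** * Polar angles *)

Section Angle.
Context {R : realType}.
Implicit Types (x : R * R) (a b t : R).

Lemma radE x : rad x ^+ 2 = x.1 ^+ 2 + x.2 ^+ 2.
Proof. by rewrite sqr_sqrtr // addr_ge0 // sqr_ge0. Qed.

Lemma rad_ge0 x : 0 <= rad x. Proof. exact: sqrtr_ge0. Qed.

Lemma rad_gt0 x : (0 < rad x) = (x != 0).
Proof.
rewrite /rad sqrtr_gt0; case: x => a b /=; apply/idP/idP.
  by apply: contraTneq => -[-> ->]; rewrite !expr0n /= addr0 ltxx.
move=> /eqP h; rewrite lt_def addr_ge0 ?sqr_ge0 // andbT.
rewrite paddr_eq0 ?sqr_ge0 // !sqrf_eq0; apply/negP => /andP[/eqP a0 /eqP b0].
by apply: h; rewrite a0 b0.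
Qed.

Lemma sin_atan t : sin (atan t) = t / Num.sqrt (1 + t ^+ 2).
Proof.
have ct : cos (atan t) != 0.
  by rewrite cos_atan invr_eq0 gt_eqF// sqrtr_gt0 ltr_wpDr // sqr_ge0.
by rewrite -cos_atan -{2}(atanK t) /tan mulfVK.
Qed.

(** A polar angle given by arctangents of [x.1 / x.2]: along a horizontal line
    off the axis it differs from [- atan (x.1 / x.2)] by a constant, so that it
    is smooth there, and its measurability is immediate. *)
Definition ang x : R :=
  if 0 < x.2 then pi / 2 - atan (x.1 / x.2)
  else if x.2 < 0 then - (pi / 2) - atan (x.1 / x.2)
  else if 0 <= x.1 then 0 else pi.

(** The same angle up to a multiple of [2 * pi], smooth along vertical lines off
    the axis, across the half-line where [ang] jumps. *)
Definition vang x : R := atan (x.2 / x.1) + (if 0 < x.1 then 0 else pi).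

Lemma sqrt_ratio a b : b != 0 ->
  Num.sqrt (1 + (a / b) ^+ 2) = rad (a, b) / `|b|.
Proof.
move=> b0; have -> : 1 + (a / b) ^+ 2 = (a ^+ 2 + b ^+ 2) / b ^+ 2 by field.
by rewrite sqrtrM ?addr_ge0 ?sqr_ge0// sqrtrV ?sqr_ge0// sqrtr_sqr.
Qed.

Lemma ang_spec x : x.1 = rad x * cos (ang x) /\ x.2 = rad x * sin (ang x).
Proof.
case: x => a b; rewrite /ang /=.
have [b0|b0|b0] := ltgtP 0 b.
- have rp : 0 < rad (a, b) by rewrite rad_gt0; apply/eqP => -[_ /eqP]; rewrite gt_eqF.
  have b0' : b != 0 by rewrite gt_eqF.
  rewrite cosB sinB cos_pihalf sin_pihalf sin_atan cos_atan sqrt_ratio // gtr0_norm //.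
  by split; field; rewrite b0' gt_eqF.
- have rp : 0 < rad (a, b) by rewrite rad_gt0; apply/eqP => -[_ /eqP]; rewrite lt_eqF.
  have b0' : b != 0 by rewrite lt_eqF.
  rewrite cosB sinB cosN sinN cos_pihalf sin_pihalf sin_atan cos_atan sqrt_ratio // ltr0_norm //.
  by split; field; rewrite b0' gt_eqF.
- rewrite -b0; have e : rad (a, 0) = `|a| by rewrite /rad /= expr0n addr0 sqrtr_sqr.
  rewrite e; have [a0|a0] := leP 0 a.
    by rewrite cos0 sin0 ger0_norm // mulr1 mulr0.
  by rewrite cospi sinpi ltr0_norm // mulr0 mulrN mulr1 opprK.
Qed.

Lemma vang_spec x : x.1 != 0 ->
  x.1 = rad x * cos (vang x) /\ x.2 = rad x * sin (vang x).
Proof.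
case: x => a b /= a0; rewrite /vang /=.
have er : rad (b, a) = rad (a, b) by rewrite /rad /= addrC.
have rp : 0 < rad (a, b) by rewrite rad_gt0; apply/eqP => -[/eqP]; rewrite (negPf a0).
have rp' : rad (a, b) != 0 by rewrite gt_eqF.
have [ap|ap] := ltP 0 a.
  rewrite addr0 sin_atan cos_atan sqrt_ratio // gtr0_norm // er.
  by split; field; rewrite rp' a0.
have an : a < 0 by rewrite lt_neqAle a0.
rewrite cosD sinD cospi sinpi sin_atan cos_atan sqrt_ratio // ltr0_norm // er.
by split; field; rewrite rp' a0.
Qed.

(** Functions on the unit circle, encoded as the functions of an angle that
    factor through its cosine and sine. Two angles of the same point may then be
    exchanged without counting turns. *)
Definition circular {T : Type} (W : R -> T) : Prop :=
  forall a b, cos a = cos b -> sin a = sin b -> W a = W b.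

Lemma circular_polar {T : Type} (W : R -> T) x a : circular W -> x != 0 ->
  x.1 = rad x * cos a -> x.2 = rad x * sin a -> W (ang x) = W a.
Proof.
move=> cW x0 h1 h2; have [k1 k2] := ang_spec x.
have r0 : rad x != 0 by rewrite gt_eqF ?rad_gt0.
by apply: cW; apply: (mulfI r0); [rewrite -k1|rewrite -k2].
Qed.

Lemma circular_ang {T : Type} (W : R -> T) a r : circular W -> 0 < r ->
  W (ang (r * cos a, r * sin a)) = W a.
Proof.
move=> cW r0; have e : rad (r * cos a, r * sin a) = r.
  rewrite /rad /= !exprMn -mulrDr cos2Dsin2 mulr1 sqrtr_sqr gtr0_norm //.
by apply: circular_polar; rewrite // ?e // -rad_gt0 e.
Qed.

Lemma circular_vang {T : Type} (W : R -> T) x : circular W -> x.1 != 0 ->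
  W (ang x) = W (vang x).
Proof.
move=> cW x0; have [h1 h2] := vang_spec x0.
by apply: circular_polar => //; apply: contra_neq x0 => ->.
Qed.

(** Shifting two angles with the same cosine and sine keeps these equal, so the
    difference quotients agree. *)
Lemma circular_derive1 {V : normedModType R} (W : R -> V) :
  circular W -> circular (derive1 W).
Proof.
move=> cW a b h1 h2; rewrite /derive1.
suff -> : (fun h => h^-1 *: (W (h + a) - W a)) =
    (fun h => h^-1 *: (W (h + b) - W b)) by [].
apply/funext => h; rewrite (cW a b) //; congr (_ *: (_ - _)).
by apply: cW; rewrite ?cosD ?sinD h1 h2.
Qed.

Lemma ang_bound x : - pi <= ang x <= pi.
Proof.
have p := pi_gt0 R; rewrite /ang.
have := atan_gtNpi2 (x.1 / x.2); have := atan_ltpi2 (x.1 / x.2).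
by case: ifP => _; [|case: ifP => _; [|case: ifP => _]]; lra.
Qed.

(** Every angle may be replaced by a value of [ang], which lies in the compact
    interval [- pi, pi]. *)
Lemma circular_bounded (W : R -> R) : circular W -> continuous W ->
  exists2 M, 0 <= M & forall t, `|W t| <= M.
Proof.
move=> cW ctW; have p := pi_gt0 R.
have lep : - pi <= pi :> R by lra.
have [c _ hc] := @EVT_max R (fun t => `|W t|) _ _ lep
  (continuous_subspaceT (fun s => continuous_comp (ctW s) (@norm_continuous _ _ _))).
exists `|W c| => // t; rewrite -(@circular_ang _ W t 1) ?ltr01 //.
by apply: hc; rewrite in_itv /= ang_bound.
Qed.

End Angle.

(** * Measurability in the plane and integrability of [1 / rad] *)

Section PlaneMeasure.
Context {R : realType}.

Local Notation mu := (@lebesgue_measure R).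
Local Notation T2 := (measurableTypeR R * measurableTypeR R)%type.
Local Notation mu2 := (@lebesgue_measure R \x @lebesgue_measure R)%E.

(** An open set is the union of the countably many rational boxes that it contains. *)
Lemma open_measurable2 (U : set (R * R)) : open U -> measurable U.
Proof.
move=> oU.
pose box (q : rat * rat * rat) : set (R * R) :=
  `](ratr q.1.1 - ratr q.2), (ratr q.1.1 + ratr q.2)[%classic `*`
  `](ratr q.1.2 - ratr q.2), (ratr q.1.2 + ratr q.2)[%classic.
have -> : U = \bigcup_q (if `[< box q `<=` U >] then box q else set0).
  apply/seteqP; split => [[x y] Uxy|z [q _]]; last by case: asboolP => // qU /qU.
  have /nbhs_ballP[e /= e0 eU] : nbhs (x, y) U by exact: open_nbhs_nbhs.
  have [r] : exists r : rat, ratr r \in `]0, (e / 2)[.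
    by apply: rat_in_itvoo; rewrite divr_gt0.
  rewrite in_itv /= => /andP[r0 re].
  have [p] : exists p : rat, ratr p \in `](x - ratr r), (x + ratr r)[.
    by apply: rat_in_itvoo; lra.
  have [q] : exists q : rat, ratr q \in `](y - ratr r), (y + ratr r)[.
    by apply: rat_in_itvoo; lra.
  rewrite !in_itv /= => /andP[q1 q2] /andP[p1 p2].
  exists (p, q, r) => //; case: asboolP => [_|]; last first.
    case=> -[a b] [] /=; rewrite !in_itv /= => /andP[a1 a2] /andP[b1 b2].
    by apply: eU; split; rewrite /ball /= ltr_norml; lra.
  by split; rewrite /= in_itv /=; lra.
apply: countable_bigcupT_measurable => // q.
by case: asboolP => // _; apply: measurableX => //; exact: measurable_itv.
Qed.

Lemma continuous_measurable2 (f : R * R -> R) :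
  continuous f -> measurable_fun setT f.
Proof.
move=> /continuousP cf; apply: (measurability _ (RGenOInfty.measurableE R)).
move=> _ [_ [a ->] <-]; rewrite setTI.
by apply: open_measurable2; exact/cf/interval_open.
Qed.

Lemma measurable_inv : measurable_fun setT (@GRing.inv R).
Proof.
have -> : @GRing.inv R = (fun x => if x == 0 then 0 else x^-1).
  by apply/funext => x; case: eqVneq => // ->; rewrite invr0.
apply: measurable_fun_if => //.
  by apply: (measurable_fun_eqr (f := id) (g := cst 0)) => //.
rewrite setTI; apply: open_continuous_measurable_fun.
  have -> : ((fun x : R => x == 0) @^-1` [set false]) = [set x | x != 0].
    by apply/seteqP; split => x /=; case: eqVneq.
  exact: open_neq.
by move=> x; rewrite inE /= => x0; apply: inv_continuous; rewrite x0.
Qed.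

Lemma rad_continuous : continuous (@rad R).
Proof.
move=> x; apply: continuous_comp; last exact: sqrt_continuous.
by apply: cvgD; apply: cvgM; [exact: cvg_fst|exact: cvg_fst|exact: cvg_snd|exact: cvg_snd].
Qed.

Lemma measurable_ang : measurable_fun setT (@ang R).
Proof.
have mq : measurable_fun setT (fun x : R * R => atan (x.1 / x.2)).
  apply: measurableT_comp; last first.
    apply: measurable_funM => //.
    by apply: measurableT_comp => //; exact: measurable_inv.
  by apply: continuous_measurable_fun => x; exact: continuous_atan.
apply: measurable_fun_ifT.
- exact: measurable_fun_ltr.
- exact: measurable_funB.
apply: measurable_fun_ifT.
- exact: measurable_fun_ltr.
- exact: measurable_funB.
by apply: measurable_fun_ifT => //; exact: measurable_fun_ler.
Qed.

Lemma lebesgue_axis1 : mu2 ([set 0] `*` setT) = 0%E.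
Proof.
rewrite [LHS](_ : _ = mu [set 0%R] * mu setT)%E; last exact: product_measure1E.
by rewrite lebesgue_measure_set1 mul0e.
Qed.

Lemma lebesgue_axis2 : mu2 (setT `*` [set 0]) = 0%E.
Proof.
rewrite [LHS](_ : _ = mu setT * mu [set 0%R])%E; last exact: product_measure1E.
by rewrite lebesgue_measure_set1 mule0.
Qed.

(** This is [|t|^(-1/2)] cut off outside [-1, 1], with value [0] at [0]. *)
Definition rsqrt (t : R) : R := if `|t| <= 1 then (Num.sqrt `|t|)^-1 else 0.

Lemma rsqrt_ge0 t : 0 <= rsqrt t.
Proof. by rewrite /rsqrt; case: ifP => // _; rewrite invr_ge0 sqrtr_ge0. Qed.

Lemma measurable_rsqrt : measurable_fun setT rsqrt.
Proof.
have mn : measurable_fun setT (fun t : R => `|t|).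
  by apply: continuous_measurable_fun; exact: norm_continuous.
apply: measurable_fun_ifT => //; first exact: measurable_fun_ler.
apply: measurableT_comp; first exact: measurable_inv.
apply: measurableT_comp => //.
by apply: continuous_measurable_fun; exact: sqrt_continuous.
Qed.

Lemma integral_inv_sqrt (a : R) : 0 < a < 1 ->
  (\int[mu]_(t in `[a, 1%R]) (rsqrt t)%:E <= 2%:E)%E.
Proof.
move=> /andP[a0 a1].
have e (t : R) : t \in `[a, 1] -> rsqrt t = (Num.sqrt t)^-1.
  rewrite in_itv /= => /andP[at_ t1].
  by rewrite /rsqrt ger0_norm ?t1 // (le_trans (ltW a0)).
have dF (t : R) : 0 < t -> is_derive t 1 (fun t : R => 2 * Num.sqrt t) (Num.sqrt t)^-1.
  move=> t0; have ? := is_derive1_sqrt t0.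
  apply: is_derive_eq.
  by have := t0; rewrite -sqrtr_gt0 => s0; rewrite /GRing.scale /=; field; rewrite gt_eqF.
have cF (t : R) : 0 < t -> {for t, continuous (fun t : R => 2 * Num.sqrt t)}.
  by move=> t0; apply/differentiable_continuous/derivable1_diffP; case: (dF t t0).
under eq_integral => t ti.
  rewrite (e t); last by move: ti; rewrite inE.
  over.
rewrite (continuous_FTC2 (F := fun t : R => 2 * Num.sqrt t)) //.
- rewrite -EFinB lee_fin sqrtr1 mulr1 gerBl //.
- apply: derivable_within_continuous => t; rewrite in_itv /= => /andP[at_ _].
  have t0 : 0 < t by exact: lt_le_trans at_.
  apply: derivableV; last by case: (is_derive1_sqrt t0).
  by rewrite gt_eqF // sqrtr_gt0.
- split.
  + move=> t; rewrite in_itv /= => /andP[at_ _].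
    by case: (dF t (lt_trans a0 at_)).
  + by apply: cvg_at_right_filter; exact: cF.
  + by apply: cvg_at_left_filter; exact: cF.
- move=> t; rewrite in_itv /= => /andP[at_ _].
  by rewrite derive1E; apply: derive_val; exact: dF (lt_trans a0 at_).
Qed.

Lemma integral_inv_sqrtN (a : R) : 0 < a < 1 ->
  (\int[mu]_(t in `[(- 1)%R, (- a)%R]) (rsqrt t)%:E <= 2%:E)%E.
Proof.
move=> /andP[a0 a1].
rewrite integration_by_substitution_oppr ?(ltW a1) //.
  under eq_integral => t _ do rewrite /= /rsqrt normrN -/(rsqrt t).
  by apply: integral_inv_sqrt; rewrite a0.
have e : {in `[(- 1), (- a)]%classic, (fun t => (Num.sqrt `|t|)^-1) =1 rsqrt}.
  move=> t; rewrite inE /= in_itv /= => /andP[t1 t2].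
  by rewrite /rsqrt ler_norml t1 (le_trans t2) //; lra.
have c (t : R) : t != 0 -> {for t, continuous (fun t : R => (Num.sqrt `|t|)^-1)}.
  move=> t0; apply: (@continuousV _ _ (fun t : R => Num.sqrt `|t|)).
    by rewrite sqrtr_eq0 -ltNge normr_gt0.
  apply: (@continuous_comp R R R (fun t => `|t|)); first exact: norm_continuous.
  exact: sqrt_continuous.
apply: (subspace_eq_continuous e); apply: continuous_in_subspaceT => t.
rewrite inE /= in_itv /= => /andP[_ ta].
by apply: c; rewrite lt_eqF //; lra.
Qed.

Lemma measurable_rsqrtE : measurable_fun setT (EFin \o rsqrt).
Proof. by apply/measurable_EFinP; exact: measurable_rsqrt. Qed.

(** The singularity at [0] is approached by monotone convergence, which turns a
    uniform bound of the integrals away from [0] into a bound of the whole. *)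
Lemma integral_bigcup_le (F : (set R)^nat) (M : \bar R) :
  nondecreasing_seq F -> (forall n, measurable (F n)) ->
  (forall n, \int[mu]_(t in F n) (rsqrt t)%:E <= M)%E ->
  (\int[mu]_(t in \bigcup_n F n) (rsqrt t)%:E <= M)%E.
Proof.
move=> nF mF FM.
have mr n : measurable_fun (F n) (EFin \o rsqrt).
  by apply: measurable_funTS; exact: measurable_rsqrtE.
have r0 n t : F n t -> (0 <= (rsqrt t)%:E)%E by rewrite lee_fin rsqrt_ge0.
have /cvg_lim <- // := ge0_nondecreasing_set_cvg_integral (mu := mu) nF mF mr r0.
apply: lime_le; last by near=> n; exact: FM.
apply: ereal_nondecreasing_is_cvgn.
exact: (ge0_nondecreasing_set_nondecreasing_integral mu nF mF mr r0).
Unshelve. all: by end_near. Qed.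

Lemma inv_nat_small (t : R) : 0 < t -> exists n, n.+2%:R^-1 <= t.
Proof.
move=> t0; exists (Num.bound t^-1).
rewrite -[leRHS]invrK lef_pV2 ?posrE ?invr_gt0 //.
have := archi_boundP (ltW (etrans (invr_gt0 t) t0)).
by move=> /ltW h; rewrite (le_trans h) // ler_nat -addn2 leq_addr.
Qed.

Lemma inv_nat_oo n : 0 < (n.+2%:R^-1 : R) < 1.
Proof. by rewrite invr_gt0 ltr0n /= invf_lt1 // ltr1n. Qed.

Lemma inv_nat_le n m : (n <= m)%N -> (m.+2%:R^-1 : R) <= n.+2%:R^-1.
Proof. by move=> nm; rewrite lef_pV2 ?posrE // ler_nat. Qed.

Lemma integral_rsqrt : (\int[mu]_t (rsqrt t)%:E < +oo)%E.
Proof.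
have h1 : (\int[mu]_(t in `]0%R, 1%R]) (rsqrt t)%:E <= 2%:E)%E.
  have -> : `]0, 1]%classic = \bigcup_n `[(n.+2%:R^-1 : R), 1]%classic.
    apply/seteqP; split => [t|t [n _]]; rewrite /= !in_itv /=; last first.
      by have /andP[n0 _] := inv_nat_oo n => /andP[h ->]; rewrite andbT (lt_le_trans n0).
    by move=> /andP[/inv_nat_small[n nt] t1]; exists n => //=; rewrite in_itv /= nt.
  apply: integral_bigcup_le.
  - move=> n m /inv_nat_le nm; apply/subsetPset => t; rewrite /= !in_itv /=.
    by move=> /andP[h ->]; rewrite andbT (le_trans _ h).
  - by move=> n; exact: measurable_itv.
  - by move=> n; exact/integral_inv_sqrt/inv_nat_oo.
have h2 : (\int[mu]_(t in `[(- 1)%R, 0%R[) (rsqrt t)%:E <= 2%:E)%E.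
  have -> : `[- 1, 0[%classic = \bigcup_n `[- 1, (- n.+2%:R^-1 : R)]%classic.
    apply/seteqP; split => [t|t [n _]]; rewrite /= !in_itv /=; last first.
      have /andP[n0 _] := inv_nat_oo n => /andP[-> h] /=.
      by rewrite (le_lt_trans h) // oppr_lt0.
    rewrite -oppr_gt0 => /andP[t1 /inv_nat_small[n nt]].
    by exists n => //=; rewrite in_itv /= t1 lerNr.
  apply: integral_bigcup_le.
  - move=> n m /inv_nat_le nm; apply/subsetPset => t; rewrite /= !in_itv /=.
    by move=> /andP[-> h] /=; rewrite (le_trans h) // lerN2.
  - by move=> n; exact: measurable_itv.
  - by move=> n; exact/integral_inv_sqrtN/inv_nat_oo.
have -> : (\int[mu]_t (rsqrt t)%:E =
    \int[mu]_(t in `]0%R, 1%R]) (rsqrt t)%:E +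
    \int[mu]_(t in `[(- 1)%R, 0%R[) (rsqrt t)%:E)%E.
  rewrite -ge0_integral_setU //=; last first.
  - apply/disj_setPS => t [] /=; rewrite !in_itv /= => /andP[h _] /andP[_ h'].
    by have := lt_trans h h'; rewrite ltxx.
  - by move=> t _; rewrite lee_fin rsqrt_ge0.
  - by apply: measurable_funTS; exact: measurable_rsqrtE.
  rewrite [RHS]integral_mkcond; apply: eq_integral => t _.
  rewrite /patch; case: ifPn => //; rewrite notin_setE /= !in_itv /= => h.
  congr (_%:E); rewrite /rsqrt; case: ifP => // t1.
  move: t1; rewrite ler_norml => /andP[t1 t2]; have [t0|t0|<-] := ltgtP 0 t.
  - by case: h; left; rewrite t0.
  - by case: h; right; rewrite t1.
  - by rewrite normr0 sqrtr0 invr0.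
by apply: (le_lt_trans (leeD h1 h2)); rewrite -EFinD ltry.
Qed.

(** Because [|x1| |x2| <= |x|^2], the singularity of [1 / rad] splits into one
    singularity for each variable. *)
Lemma inv_rad_le (x : R * R) : x.1 != 0 -> x.2 != 0 -> rad x < 1 ->
  (rad x)^-1 <= rsqrt x.1 * rsqrt x.2.
Proof.
case: x => a b /= a0 b0 r1.
have rp : 0 < rad (a, b) by rewrite rad_gt0; apply/eqP => -[/eqP]; rewrite (negPf a0).
have la : `|a| <= rad (a, b).
  by rewrite -sqrtr_sqr ler_sqrt /= ?addr_ge0 ?sqr_ge0 // lerDl sqr_ge0.
have lb : `|b| <= rad (a, b).
  by rewrite -sqrtr_sqr ler_sqrt /= ?addr_ge0 ?sqr_ge0 // lerDr sqr_ge0.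
rewrite /rsqrt (le_trans la (ltW r1)) (le_trans lb (ltW r1)) -invfM -sqrtrM //.
rewrite lef_pV2 ?posrE ?sqrtr_gt0 ?mulr_gt0 ?normr_gt0 //.
rewrite /rad /= ler_sqrt ?addr_ge0 ?sqr_ge0 // -normrM ler_norml.
have := sqr_ge0 (a + b); have := sqr_ge0 (a - b); rewrite sqrrB sqrrD.
  by have := sqr_ge0 a; have := sqr_ge0 b; lra.
by rewrite -radE exprn_gt0.
Qed.

Lemma integrable_rsqrt2 :
  mu2.-integrable setT (fun x => (rsqrt x.1 * rsqrt x.2)%:E).
Proof.
have m2 : measurable_fun setT (fun x : R * R => (rsqrt x.1 * rsqrt x.2)%:E).
  apply/measurable_EFinP; apply: measurable_funM.
    by apply: measurableT_comp => //; exact: measurable_rsqrt.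
  by apply: measurableT_comp => //; exact: measurable_rsqrt.
suff : (mu \x mu)%E.-integrable setT (fun x : R * R => (rsqrt x.1 * rsqrt x.2)%:E) by []. apply: (integrable12ltyP mu mu m2).2.
have r0 t : (0 <= (rsqrt t)%:E)%E by rewrite lee_fin rsqrt_ge0.
under eq_integral => x _.
  under eq_integral => y _ do
    rewrite /= normrM !ger0_norm ?rsqrt_ge0 // EFinM.
  rewrite ge0_integralZl //=; last exact: measurable_rsqrtE.
  over.
rewrite ge0_integralZr //=; last 2 first.
- exact: measurable_rsqrtE.
- exact: integral_ge0.
have h := integral_rsqrt; rewrite -ge0_fin_numE in h; last exact: integral_ge0.
by rewrite -(fineK h) -EFinM ltry.
Qed.

(** A function of size [1 / rad] is integrable on the disk: off the axes, which
    are negligible, [1 / rad] is at most [|x1|^(-1/2) |x2|^(-1/2)], a product of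
    integrable functions of one variable. *)
Lemma integrable_of_inv_rad (D : R * R -> R) (M : R) :
  measurable_fun setT D -> (forall x, 1 <= rad x -> D x = 0) ->
  (forall x, x != 0 -> `|D x| <= M / rad x) -> mu2.-integrable setT (EFin \o D).
Proof.
move=> mD D0 DM.
have mED : measurable_fun [set: T2] (EFin \o D) by exact/measurable_EFinP.
pose N : set T2 := ([set 0] `*` setT) `|` (setT `*` [set 0]).
have mN : measurable N by apply: measurableU; exact: measurableX.
have N0 : mu2 N = 0%E.
  by apply: null_set_setU; [exact: measurableX|exact: measurableX|exact: lebesgue_axis1|exact: lebesgue_axis2].
apply: (negligible_integrable mN measurableT mED N0).2.
have h : mu2.-integrable (setT `\` N) (fun x => (M%:E * (rsqrt x.1 * rsqrt x.2)%:E)%E).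
  apply: integrableZl => //; first exact: measurableD.
  by apply: (integrableS _ _ _ integrable_rsqrt2) => //; exact: measurableD.
apply: (le_integrable _ _ _ h); [exact: measurableD|exact: measurable_funTS|].
move=> x [_ xN]; rewrite /= lee_fin.
have x1 : x.1 != 0 by apply/eqP => x1; apply: xN; left; split.
have x2 : x.2 != 0 by apply/eqP => x2; apply: xN; right; split.
have x0 : x != 0 by apply: contra_neq x1 => ->.
have M0 : 0 <= M.
  have := le_trans (normr_ge0 _) (DM x x0).
  by rewrite pmulr_lge0 // invr_gt0 rad_gt0.
have [/D0 ->|r1] := leP 1 (rad x); first by rewrite normr0.
apply: (le_trans (DM x x0)); rewrite (le_trans _ (ler_norm _)) //.
by rewrite ler_wpM2l // inv_rad_le.
Qed.

End PlaneMeasure.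

(** * Divergence-free integrals in polar form *)

Section Divergence.
Context {R : realType}.

Local Notation mu := (@lebesgue_measure R).
Local Notation T2 := (measurableTypeR R * measurableTypeR R)%type.
Local Notation mu2 := (@lebesgue_measure R \x @lebesgue_measure R)%E.

Lemma is_derive_continuous (F : R -> R) (t d : R) : is_derive t 1 F d -> {for t, continuous F}.
Proof. by move=> [dF _]; apply/differentiable_continuous/derivable1_diffP. Qed.

Lemma integral_derive_compact (F d : R -> R) :
  (forall t : R, is_derive t 1 F (d t)) -> continuous d ->
  (forall t, 1 <= `|t| -> F t = 0) -> (forall t, 1 <= `|t| -> d t = 0) ->
  (\int[mu]_t (d t)%:E = 0)%E.
Proof.
move=> dF cd F0 d0.
have cF (t : R) : {for t, continuous F} by exact: is_derive_continuous (dF t).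
have -> : (\int[mu]_t (d t)%:E = \int[mu]_(t in `[(- 1)%R, 1%R]) (d t)%:E)%E.
  rewrite [RHS]integral_mkcond; apply: eq_integral => t _.
  rewrite /patch; case: ifPn => //; rewrite notin_setE /= in_itv /= => h.
  by rewrite d0 //; move/negP: h; rewrite -ler_norml -ltNge => /ltW.
rewrite (continuous_FTC2 (F := F)) //.
- by rewrite !F0 ?normrN ?normr1 // sube0.
- exact: continuous_subspaceT.
- split.
  + by move=> t _; case: (dF t).
  + by apply: cvg_at_right_filter; exact: cF.
  + by apply: cvg_at_left_filter; exact: cF.
- by move=> t _; rewrite derive1E; apply: derive_val; exact: dF.
Qed.

(** It is enough to integrate along the lines that avoid the origin, since the
    remaining one is negligible. *)
Lemma fubini_zero2 (D : T2 -> R) : mu2.-integrable setT (EFin \o D) ->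
  (forall y, y != 0 -> (\int[mu]_x (D (x, y))%:E = 0)%E) ->
  (\int[mu2]_x (D x)%:E = 0)%E.
Proof.
move=> iD D0; rewrite -(integral21_prod_meas1 iD).
rewrite (ae_eq_integral (cst 0%E)) ?integral0 //; first exact: measurable_fubini_G iD.
exists [set 0 : R]; split => //; first exact: lebesgue_measure_set1.
by move=> y /=; apply: contra_notP => /eqP y0 _; exact: D0.
Qed.

Lemma fubini_zero1 (D : T2 -> R) : mu2.-integrable setT (EFin \o D) ->
  (forall x, x != 0 -> (\int[mu]_y (D (x, y))%:E = 0)%E) ->
  (\int[mu2]_x (D x)%:E = 0)%E.
Proof.
move=> iD D0; rewrite -(integral12_prod_meas1 iD).
rewrite (ae_eq_integral (cst 0%E)) ?integral0 //; first exact: measurable_fubini_F iD.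
exists [set 0 : R]; split => //; first exact: lebesgue_measure_set1.
by move=> y /=; apply: contra_notP => /eqP y0 _; exact: D0.
Qed.

Lemma is_derive_ang (y t : R) : y != 0 ->
  is_derive t 1 (fun t => ang (t, y)) (- y / rad (t, y) ^+ 2).
Proof.
move=> y0; have [c ->] : exists c, (fun t => ang (t, y)) = (fun t => c - atan (t / y)).
  rewrite /ang /=; have [yp|yn|y0'] := ltgtP 0 y.
  - by exists (pi / 2).
  - by exists (- (pi / 2)).
  - by rewrite -y0' eqxx in y0.
have ? : is_derive (t / y) 1 (@atan R) (1 + (t / y) ^+ 2)^-1 by exact: is_derive1_atan.
have ? : is_derive t 1 (fun t : R => t / y) y^-1.
  by apply: is_derive_eq; rewrite scaler0 add0r scaler1.
have ? : is_derive t 1 (fun t : R => atan (t / y)) ((1 + (t / y) ^+ 2)^-1 * y^-1).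
  exact: is_derive1_comp.
apply: is_derive_eq; rewrite radE /=.
have h : t ^+ 2 + y ^+ 2 != 0.
  by rewrite gt_eqF // ltr_wpDl ?sqr_ge0 // lt_def sqr_ge0 sqrf_eq0 y0.
have h' : 1 + (t / y) ^+ 2 != 0 by rewrite gt_eqF // ltr_wpDr // sqr_ge0.
have h'' : y ^+ 2 + t ^+ 2 != 0 by rewrite addrC.
by field; rewrite y0 h.
Qed.

Lemma is_derive_vang (x t : R) : x != 0 ->
  is_derive t 1 (fun t => vang (x, t)) (x / rad (x, t) ^+ 2).
Proof.
move=> x0; rewrite /vang /=; set c := if _ then _ else _.
have ? : is_derive (t / x) 1 (@atan R) (1 + (t / x) ^+ 2)^-1 by exact: is_derive1_atan.
have ? : is_derive t 1 (fun t : R => t / x) x^-1.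
  by apply: is_derive_eq; rewrite scaler0 add0r scaler1.
have ? : is_derive t 1 (fun t : R => atan (t / x)) ((1 + (t / x) ^+ 2)^-1 * x^-1).
  exact: is_derive1_comp.
apply: is_derive_eq; rewrite radE /=.
have h : x ^+ 2 + t ^+ 2 != 0.
  by rewrite gt_eqF // ltr_wpDr ?sqr_ge0 // lt_def sqr_ge0 sqrf_eq0 x0.
by field; rewrite x0 h.
Qed.


Lemma is_derive_hline (V : normedModType R) (chi : R * R -> V) (t y : R) d :
  is_derive ((t, y) : R * R) ((1, 0) : R * R) chi d <->
  is_derive t 1 (fun t => chi (t, y)) d.
Proof.
have e : (fun h : R => h^-1 *: (chi (h *: ((1, 0) : R * R) + (t, y)) - chi (t, y))) =
         (fun h : R => h^-1 *: (chi (h *: (1 : R) + t, y) - chi (t, y))).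
  apply/funext => h.
  have -> : h *: ((1, 0) : R * R) + (t, y) = (h *: (1 : R) + t, h *: (0 : R) + y) by [].
  by rewrite scaler0 add0r.
split=> -[dc <-]; constructor; move: dc; rewrite /derivable /derive e //.
Qed.

Lemma is_derive_vline (V : normedModType R) (chi : R * R -> V) (x t : R) d :
  is_derive ((x, t) : R * R) ((0, 1) : R * R) chi d <->
  is_derive t 1 (fun t => chi (x, t)) d.
Proof.
have e : (fun h : R => h^-1 *: (chi (h *: ((0, 1) : R * R) + (x, t)) - chi (x, t))) =
         (fun h : R => h^-1 *: (chi (x, h *: (1 : R) + t) - chi (x, t))).
  apply/funext => h.
  have -> : h *: ((0, 1) : R * R) + (x, t) = (h *: (0 : R) + x, h *: (1 : R) + t) by [].
  by rewrite scaler0 add0r.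
split=> -[dc <-]; constructor; move: dc; rewrite /derivable /derive e //.
Qed.

Lemma norm_coord_le_rad (x : R * R) : `|x.1| <= rad x /\ `|x.2| <= rad x.
Proof.
by split; rewrite -sqrtr_sqr ler_sqrt ?addr_ge0 ?sqr_ge0 // ?lerDl ?lerDr sqr_ge0.
Qed.

Lemma continuous_bounded_disk (f : R * R -> R) : continuous f ->
  (forall x, 1 <= rad x -> f x = 0) -> exists2 M, 0 <= M & forall x, `|f x| <= M.
Proof.
move=> cf f0.
pose A := `[-1, 1]%classic `*` `[-1, 1]%classic : set (R * R).
have cA : compact A by apply: compact_setX; exact: segment_compact.
have A0 : A (0, 0) by split; rewrite /= in_itv /=; lra.
have [c _ hc] := @compact_EVT_max _ _ (fun x => `|f x|) A (ex_intro _ _ A0) cA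
  (continuous_subspaceT (fun s => continuous_comp (cf s) (@norm_continuous _ _ _))).
exists `|f c| => // x; have [xA|xA] := pselect (A x).
  by apply: hc; rewrite inE.
rewrite f0 ?normr0 // leNgt; apply: contra_notN xA => r1.
have [h1 h2] := norm_coord_le_rad x.
by split; rewrite /= in_itv /= -ler_norml ?(le_trans h1) ?(le_trans h2) // ltW.
Qed.

Definition C1_in_disk (chi c1 c2 : R * R -> R) : Prop :=
  [/\ (forall x : R * R, is_derive x ((1, 0) : R * R) chi (c1 x)),
      (forall x : R * R, is_derive x ((0, 1) : R * R) chi (c2 x)),
      [/\ continuous chi, continuous c1 & continuous c2] &
      forall x, 1 <= rad x -> [/\ chi x = 0, c1 x = 0 & c2 x = 0]].

Definition circular_C1 (W W' : R -> R) : Prop :=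
  [/\ circular W, circular W', forall t : R, is_derive t 1 W (W' t) & continuous W'].

(** The partial derivatives of [chi * W (ang x)] off the origin are [D1] and [D2]
    below. They are [O(1 / rad)], hence integrable, and their integrals vanish:
    on every line avoiding the origin the product is C1 with compact support. *)
Section Flux.
Variables (chi c1 c2 : R * R -> R) (W W' : R -> R).
Hypotheses (hchi : C1_in_disk chi c1 c2) (hW : circular_C1 W W').

Let D1 x := c1 x * W (ang x) - chi x * (x.2 / rad x ^+ 2 * W' (ang x)).
Let D2 x := c2 x * W (ang x) + chi x * (x.1 / rad x ^+ 2 * W' (ang x)).

Let cW : continuous W.
Proof. by move=> t; case: hW => _ _ /(_ t) /is_derive_continuous. Qed.

Let cW' : continuous W'. Proof. by case: hW. Qed.

Let measurable_lift (V : R -> R) : continuous V -> measurable_fun setT (V \o @ang R).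
Proof.
move=> cV; apply: measurableT_comp; last exact: measurable_ang.
exact: continuous_measurable_fun.
Qed.

(* [x1] stands for the coordinate (up to sign) that appears in the gradient of the angle *)
Let bound (c : R * R -> R) (x1 : R * R -> R) : continuous c ->
  (forall x, 1 <= rad x -> c x = 0) -> (forall x, `|x1 x| <= rad x) ->
  exists M, forall x, x != 0 ->
    `|c x * W (ang x) + chi x * (x1 x / rad x ^+ 2 * W' (ang x))| <= M / rad x.
Proof.
move=> cc c0 x1r.
have [chi_d _ [cchi _ _] chi0] := hchi.
have [circW circW' _ _] := hW.
have [M1 M10 hM1] := continuous_bounded_disk cc c0.
have [M2 M20 hM2] := continuous_bounded_disk cchi (fun x h => let: And3 a _ _ := chi0 x h in a).
have [M3 M30 hM3] := circular_bounded circW cW.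
have [M4 M40 hM4] := circular_bounded circW' cW'.
exists (M1 * M3 + M2 * M4) => x x0.
have rp : 0 < rad x by rewrite rad_gt0.
have M0 : 0 <= M1 * M3 + M2 * M4 by rewrite addr_ge0 // mulr_ge0.
have [r1|r1] := leP 1 (rad x).
  by have [-> _ _] := chi0 x r1; rewrite c0 // !mul0r addr0 normr0 divr_ge0 // ltW.
rewrite (le_trans (ler_normD _ _)) // mulrDl; apply: lerD.
  have r1' : 1 <= (rad x)^-1 by rewrite invf_ge1 // ltW.
  apply: (@le_trans _ _ (M1 * M3)); first by rewrite normrM ler_pM.
  exact: ler_peMr (mulr_ge0 M10 M30) r1'.
have h : `|x1 x / rad x ^+ 2| <= (rad x)^-1.
  rewrite normrM normfV (ger0_norm (sqr_ge0 _)) ler_pdivrMr ?exprn_gt0 //.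
  by rewrite expr2 mulrA mulVf ?gt_eqF // mul1r.
rewrite 2!normrM -mulrA [X in _ <= _ * X]mulrC.
by apply: ler_pM => //; exact: ler_pM.
Qed.

Let measurable_flux (c : R * R -> R) (p : R * R -> R) :
  continuous c -> measurable_fun setT p ->
  measurable_fun setT (fun x => c x * W (ang x) + chi x * (p x / rad x ^+ 2 * W' (ang x))).
Proof.
move=> cc mp; have [_ _ [cchi _ _] _] := hchi.
apply: measurable_funD.
  by apply: measurable_funM; [exact: continuous_measurable2|exact: measurable_lift].
apply: measurable_funM; first exact: continuous_measurable2.
apply: measurable_funM; last exact: measurable_lift.
apply: measurable_funM => //; apply: measurableT_comp; first exact: measurable_inv.
by apply: measurable_funX; apply: continuous_measurable2; exact: rad_continuous.
Qed.

Let continuous_flux (c : R * R -> R) (q : R -> R * R) (th : R -> R) (p : R -> R) :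
  continuous c -> continuous q -> continuous th -> continuous p ->
  (forall t, q t != 0) ->
  continuous (fun t => c (q t) * W (th t) + chi (q t) * (p t / rad (q t) ^+ 2 * W' (th t))).
Proof.
move=> cc cq cth cp q0 t; have [_ _ [cchi _ _] _] := hchi.
have h (V : R * R -> R) : continuous V -> {for t, continuous (fun t => V (q t))}.
  by move=> cV; apply: continuous_comp; [exact: cq|exact: cV].
have k (V : R -> R) : continuous V -> {for t, continuous (fun t => V (th t))}.
  by move=> cV; apply: continuous_comp; [exact: cth|exact: cV].
apply: cvgD; first by apply: cvgM; [exact: h|exact: k].
apply: cvgM; first exact: h.
apply: cvgM; last exact: k.
apply: cvgM; first exact: cp.
apply: cvgV; first by rewrite expf_neq0 // gt_eqF // rad_gt0.
by rewrite expr2; apply: cvgM; apply: h; exact: rad_continuous.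
Qed.

Lemma hdivergence : mu2.-integrable setT (EFin \o D1) /\
  (\int[mu2]_x (D1 x)%:E = 0)%E.
Proof.
have [d1 d2 [cchi cc1 cc2] chi0] := hchi.
have [circW circW' dW _] := hW.
have eD : D1 = (fun x => c1 x * W (ang x) + chi x * (- x.2 / rad x ^+ 2 * W' (ang x))).
  by apply/funext => x; rewrite /D1 !mulNr mulrN.
have iD : mu2.-integrable setT (EFin \o D1).
  have [M hM] := @bound c1 (fun x => - x.2) cc1
    (fun x h => let: And3 _ b _ := chi0 x h in b)
    (fun x => eq_ind_r (fun z => z <= rad x) (norm_coord_le_rad x).2 (normrN _)).
  rewrite eD; apply: (integrable_of_inv_rad (M := M)) => //.
  - apply: measurable_flux => //; apply: continuous_measurable2 => x.
    by apply: (@continuousN _ _ _ (fun x : R * R => x.2)); exact: cvg_snd.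
  - by move=> x /chi0[h1 h2 _]; rewrite h1 h2 !mul0r addr0.
split=> //; apply: fubini_zero2 => // y y0.
apply: (integral_derive_compact (F := fun t => chi (t, y) * W (ang (t, y)))).
- move=> t.
  have ? := (is_derive_hline _ _ _ _).1 (d1 (t, y)).
  have ? := is_derive_ang t y0.
  have ? : is_derive t 1 (fun t => W (ang (t, y))) (W' (ang (t, y)) * (- y / rad (t, y) ^+ 2)).
    exact: (is_derive1_comp (f := W)).
  by apply: is_derive_eq; rewrite /D1 /GRing.scale /=; ring.
- rewrite eD; have cq : continuous (fun t : R => (t, y)).
    by move=> t; apply: (@cvg_pair _ _ _ _ (nbhs t) (nbhs y)); [exact: cvg_id|exact: cvg_cst].
  have cth : continuous (fun t : R => ang (t, y)).
    by move=> t; exact: is_derive_continuous (is_derive_ang t y0).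
  have cp : continuous (fun _ : R => - y) by move=> t; exact: cvg_cst.
  apply: (continuous_flux cc1 cq cth cp) => t.
  by apply/eqP => -[_ /eqP]; rewrite (negPf y0).
- move=> t t1; have [-> _ _] := chi0 (t, y) (le_trans t1 (norm_coord_le_rad (t, y)).1).
  by rewrite mul0r.
- move=> t t1; have [h1 h2 _] := chi0 (t, y) (le_trans t1 (norm_coord_le_rad (t, y)).1).
  by rewrite /D1 h1 h2 !mul0r subr0.
Qed.

Lemma vdivergence : mu2.-integrable setT (EFin \o D2) /\
  (\int[mu2]_x (D2 x)%:E = 0)%E.
Proof.
have [d1 d2 [cchi cc1 cc2] chi0] := hchi.
have [circW circW' dW _] := hW.
have iD : mu2.-integrable setT (EFin \o D2).
  have [M hM] := @bound c2 (fun x => x.1) cc2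
    (fun x h => let: And3 _ _ b := chi0 x h in b)
    (fun x => (norm_coord_le_rad x).1).
  apply: (integrable_of_inv_rad (M := M)) => //.
  - exact: measurable_flux.
  - by move=> x /chi0[h1 _ h2]; rewrite /D2 h1 h2 !mul0r addr0.
split=> //; apply: fubini_zero1 => // x x0.
have eD : (fun t => D2 (x, t)) = (fun t => c2 (x, t) * W (vang (x, t)) +
    chi (x, t) * (x / rad (x, t) ^+ 2 * W' (vang (x, t)))).
  by apply/funext => t; rewrite /D2 (circular_vang (W := W)) // (circular_vang (W := W')).
apply: (integral_derive_compact (F := fun t => chi (x, t) * W (vang (x, t)))).
- move=> t.
  have ? := (is_derive_vline _ _ _ _).1 (d2 (x, t)).
  have ? := is_derive_vang t x0.
  have ? : is_derive t 1 (fun t => W (vang (x, t))) (W' (vang (x, t)) * (x / rad (x, t) ^+ 2)).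
    exact: (is_derive1_comp (f := W)).
  rewrite [D2 _](congr1 (fun f => f t) eD).
  by apply: is_derive_eq; rewrite /GRing.scale /=; ring.
- rewrite eD; have cq : continuous (fun t : R => (x, t)).
    by move=> t; apply: (@cvg_pair _ _ _ _ (nbhs x) (nbhs t)); [exact: cvg_cst|exact: cvg_id].
  have cth : continuous (fun t : R => vang (x, t)).
    by move=> t; exact: is_derive_continuous (is_derive_vang t x0).
  have cp : continuous (fun _ : R => x) by move=> t; exact: cvg_cst.
  apply: (continuous_flux cc2 cq cth cp) => t.
  by apply/eqP => -[/eqP]; rewrite (negPf x0).
- move=> t t1; have [-> _ _] := chi0 (x, t) (le_trans t1 (norm_coord_le_rad (x, t)).2).
  by rewrite mul0r.
- move=> t t1; have [h1 _ h2] := chi0 (x, t) (le_trans t1 (norm_coord_le_rad (x, t)).2).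
  by rewrite /D2 h1 h2 !mul0r addr0.
Qed.

End Flux.

(** [I] is the divergence, off the origin, of the vector field
    [chi * (Q e_R + P e_theta)], where [e_R] and [e_theta] are the unit vectors of
    polar coordinates: [Q e_R + P e_theta] has divergence [(Q + P') / R]. Its
    Cartesian components are [chi] times functions of the angle, so its two terms
    integrate to zero by [hdivergence] and [vdivergence]. This is integration by
    parts in polar coordinates, and it does without a change of variables. *)
Lemma polar_divergence (chi c1 c2 : R * R -> R) (Q Q' P P' : R -> R) :
  C1_in_disk chi c1 c2 -> circular_C1 Q Q' -> circular_C1 P P' ->
  let I x := Q (ang x) * (cos (ang x) * c1 x + sin (ang x) * c2 x) +
             P (ang x) * (cos (ang x) * c2 x - sin (ang x) * c1 x) +
             (Q (ang x) + P' (ang x)) * ((rad x)^-1 * chi x) in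
  mu2.-integrable setT (EFin \o I) /\ (\int[mu2]_x (I x)%:E = 0)%E.
Proof.
move=> hchi [cQ cQ' dQ kQ] [cP cP' dP kP] I.
have ccos : continuous (@cos R) by exact: continuous_cos.
have csin : continuous (@sin R) by exact: continuous_sin.
have kontQ : continuous Q by move=> t; exact: is_derive_continuous (dQ t).
have kontP : continuous P by move=> t; exact: is_derive_continuous (dP t).
have h1 : circular_C1 (fun t => Q t * cos t - P t * sin t)
    (fun t => Q' t * cos t - Q t * sin t - P' t * sin t - P t * cos t).
  split.
  - by move=> a b e1 e2; rewrite (cQ a b) // (cP a b) // e1 e2.
  - by move=> a b e1 e2; rewrite (cQ a b) // (cP a b) // (cQ' a b) // (cP' a b) // e1 e2.
  - move=> t; have ? := dQ t; have ? := dP t.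
    by apply: is_derive_eq; rewrite /GRing.scale /=; ring.
  - by move=> t; repeat apply: cvgB; apply: cvgM; done || exact: ccos || exact: csin
       || exact: kontQ || exact: kontP || exact: kQ || exact: kP.
have h2 : circular_C1 (fun t => Q t * sin t + P t * cos t)
    (fun t => Q' t * sin t + Q t * cos t + P' t * cos t - P t * sin t).
  split.
  - by move=> a b e1 e2; rewrite (cQ a b) // (cP a b) // e1 e2.
  - by move=> a b e1 e2; rewrite (cQ a b) // (cP a b) // (cQ' a b) // (cP' a b) // e1 e2.
  - move=> t; have ? := dQ t; have ? := dP t.
    by apply: is_derive_eq; rewrite /GRing.scale /=; ring.
  - by move=> t; apply: cvgB; [repeat apply: cvgD|]; apply: cvgM; done || exact: ccos || exact: csin
       || exact: kontQ || exact: kontP || exact: kQ || exact: kP.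
have [i1 z1] := hdivergence hchi h1.
have [i2 z2] := vdivergence hchi h2.
move: i1 z1 i2 z2; set D1 := (X in (EFin \o X)); move=> i1 z1; set D2 := (X in (EFin \o X)) => i2 z2.
have eI : I = (fun x => D1 x + D2 x).
  apply/funext => x; rewrite /I /D1 /D2.
  have [e1 e2] := ang_spec x.
  have -> : x.1 / rad x ^+ 2 = cos (ang x) / rad x.
    rewrite [in LHS]e1; have [->|r0] := eqVneq (rad x) 0; first by rewrite expr0n /= invr0 !mulr0.
    by field.
  have -> : x.2 / rad x ^+ 2 = sin (ang x) / rad x.
    rewrite [in LHS]e2; have [->|r0] := eqVneq (rad x) 0; first by rewrite expr0n /= invr0 !mulr0.
    by field.
  have := cos2Dsin2 (ang x); set c := cos _; set s := sin _ => cs.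
  set q := Q _; set q' := Q' _; set p := P _; set p' := P' _; set r := (rad x)^-1.
  have -> : (q + p') * (r * chi x) = (c ^+ 2 + s ^+ 2) * ((q + p') * (r * chi x)).
    by rewrite cs mul1r.
  by ring.
have eE : EFin \o I = (EFin \o D1) \+ (EFin \o D2).
  by apply/funext => x; rewrite eI /= EFinD.
split; first by rewrite eE; exact: integrableD.
under eq_integral => x _ do rewrite [(I x)%:E](congr1 (fun f => f x) eE).
by rewrite integralD //= z1 z2 adde0.
Qed.

End Divergence.

(** * Test functions and the weak form in polar coordinates *)

Section TestFunctions.
Context {R : realType}.

Local Notation mu2 := (@lebesgue_measure R \x @lebesgue_measure R)%E.
Local Notation T2 := (measurableTypeR R * measurableTypeR R)%type.
Local Notation e1 := ((1, 0) : R * R).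
Local Notation e2 := ((0, 1) : R * R).

Lemma mxdotE m n (F G : 'M[R]_(m, n)) : mxdot F G = \sum_i \sum_j F i j * G i j.
Proof.
rewrite /mxdot /mxtrace exchange_big; apply: eq_bigr => j _.
by rewrite mxE; apply: eq_bigr => i _; rewrite mxE.
Qed.

Lemma mxdot_col m (v w : 'cV[R]_m) : mxdot v w = \sum_i v i 0 * w i 0.
Proof. by rewrite mxdotE; apply: eq_bigr => i _; rewrite big_ord1. Qed.

Lemma mxdot_tensor m n (a c : 'cV[R]_m) (b d : 'cV[R]_n) :
  mxdot (tensor a b) (tensor c d) = mxdot a c * mxdot b d.
Proof.
rewrite !mxdot_col big_distrlr mxdotE /=; apply: eq_bigr => i _.
by apply: eq_bigr => j _; rewrite !mxE !big_ord1 !mxE mulrACA.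
Qed.

Lemma mxdotDl m n (F F' G : 'M[R]_(m, n)) : mxdot (F + F') G = mxdot F G + mxdot F' G.
Proof. by rewrite /mxdot linearD mulmxDl linearD. Qed.

Lemma mxdotDr m n (F G G' : 'M[R]_(m, n)) : mxdot F (G + G') = mxdot F G + mxdot F G'.
Proof. by rewrite /mxdot mulmxDr linearD. Qed.

Lemma mxdotZl m n a (F G : 'M[R]_(m, n)) : mxdot (a *: F) G = a * mxdot F G.
Proof. by rewrite /mxdot linearZ -scalemxAl linearZ. Qed.

Lemma mxdotC m n (F G : 'M[R]_(m, n)) : mxdot F G = mxdot G F.
Proof.
by rewrite !mxdotE; apply: eq_bigr => i _; apply: eq_bigr => j _; rewrite mulrC.
Qed.

Lemma mxdotZr m n a (F G : 'M[R]_(m, n)) : mxdot F (a *: G) = a * mxdot F G.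
Proof. by rewrite mxdotC mxdotZl mxdotC. Qed.

Lemma mxdot_frame (a b : 'cV[R]_2) : mxdot a b = a 0 0 * b 0 0 + a 1 0 * b 1 0.
Proof.
rewrite mxdot_col big_ord_recl big_ord1.
by have -> : lift ord0 ord0 = 1 :> 'I_2 by exact: val_inj.
Qed.

(** The vectors [unitR x] and [unitT x] are orthonormal. *)
Lemma mxdot_polar m (x : R * R) (a b c d : 'cV[R]_m) : x != 0 ->
  mxdot (tensor a (colv (unitR x)) + tensor b (colv (unitT x)))
        (tensor c (colv (unitR x)) + tensor d (colv (unitT x))) = mxdot a c + mxdot b d.
Proof.
move=> x0; rewrite !(mxdotDl, mxdotDr, mxdot_tensor) !mxdot_frame !mxE /=.
have r0 : rad x != 0 by rewrite gt_eqF ?rad_gt0.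
have e : rad x ^+ 2 / rad x ^+ 2 = 1 by rewrite divff // expf_neq0.
have -> : x.1 / rad x * (x.1 / rad x) + x.2 / rad x * (x.2 / rad x) = 1.
  by rewrite -[RHS]e {1}radE; field.
have -> : - x.2 / rad x * (- x.2 / rad x) + x.1 / rad x * (x.1 / rad x) = 1.
  by rewrite -[RHS]e {1}radE; field.
by ring.
Qed.

Lemma measurable_disk : measurable (@disk R : set T2).
Proof.
suff : open (@disk R) by move=> /open_measurable2.
have -> : @disk R = @rad R @^-1` `]-oo, 1[%classic by apply/seteqP; split => x; rewrite /= in_itv.
by move/continuousP : (@rad_continuous R); apply; exact: interval_open.
Qed.

(** Used to discard the origin, where polar derivatives have no meaning. *)
Lemma integral_off_axis (S J : T2 -> R) :
  measurable_fun setT J -> (forall x, x.1 != 0 -> J x = S x) ->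
  mu2.-integrable setT (EFin \o S) -> (\int[mu2]_x (S x)%:E = 0)%E ->
  mu2.-integrable setT (EFin \o J) /\ (\int[mu2]_x (J x)%:E = 0)%E.
Proof.
move=> mJ eJ iS zS.
have mEJ : measurable_fun [set: T2] (EFin \o J) by exact/measurable_EFinP.
pose N : set T2 := [set 0] `*` setT.
have mN : measurable N by exact: measurableX.
have N0 : mu2 N = 0%E by exact: lebesgue_axis1.
have eN : {in setT `\` N, EFin \o S =1 EFin \o J}.
  move=> x; rewrite inE => -[_ xN]; rewrite /= eJ //.
  by apply/eqP => x1; apply: xN; split.
have iJ : mu2.-integrable setT (EFin \o J).
  apply: (negligible_integrable mN measurableT mEJ N0).2.
  apply: (eq_integrable _ _ _ eN); first exact: measurableD.
  by apply: integrableS iS => //; exact: measurableD.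
split=> //; rewrite (negligible_integral mN measurableT iJ N0).
rewrite -[RHS]zS (negligible_integral mN measurableT iS N0).
by apply: eq_integral => x xN; rewrite -[LHS]/((EFin \o J) x) -eN.
Qed.

Section Test.
Variable m : nat.
Implicit Types (phi u : R * R -> 'cV[R]_m) (x : R * R).

Lemma derive1_curve phi (q : R -> R * R) (t a b : R) :
  differentiable phi (q t) ->
  is_derive t 1 (fun t => (q t).1) a -> is_derive t 1 (fun t => (q t).2) b ->
  derive1 (phi \o q) t = a *: 'D_e1 phi (q t) + b *: 'D_e2 phi (q t).
Proof.
move=> dphi [/derivable1_diffP da <-] [/derivable1_diffP db <-].
have eq : q = (fun t => ((q t).1, (q t).2)) by apply/funext => s; case: (q s).
have dq : differentiable q t by rewrite eq; exact: differentiable_pair.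
have dpq : differentiable (phi \o q) t by exact: differentiable_comp.
have D e : 'D_e phi (q t) = 'd phi (q t) e by exact: deriveE.
have da' : 'D_1 (fun t => (q t).1) t = 'd (fun t => (q t).1) t 1 by exact: deriveE.
have db' : 'D_1 (fun t => (q t).2) t = 'd (fun t => (q t).2) t 1 by exact: deriveE.
have -> : derive1 (phi \o q) t = 'd phi (q t) ('d q t (1 : R)).
  by rewrite derive1E deriveE // diff_comp.
have -> : 'd q t (1 : R) = ('d (fun t => (q t).1) t 1, 'd (fun t => (q t).2) t 1).
  by rewrite {1}eq diff_pair.
rewrite -da' -db' !D.
suff gen (a' b' : R) : 'd phi (q t) (a', b') = a' *: 'd phi (q t) e1 + b' *: 'd phi (q t) e2.
  exact: gen.
have -> : (a', b') = a' *: e1 + b' *: e2.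
  rewrite [RHS](_ : _ = (a' *: (1 : R) + b' *: (0 : R), a' *: (0 : R) + b' *: (1 : R))) //.
  by rewrite /GRing.scale /= !mulr0 !mulr1 addr0 add0r.
by rewrite linearD; congr (_ + _); exact: linearZ.
Qed.

Lemma unit_ang x : x != 0 ->
  x.1 / rad x = cos (ang x) /\ x.2 / rad x = sin (ang x).
Proof.
move=> x0; have [h1 h2] := ang_spec x; have r0 : rad x != 0 by rewrite gt_eqF // rad_gt0.
by split; rewrite [X in X / _](h1, h2) mulrC mulKf.
Qed.

Lemma dR_test phi x : x != 0 -> differentiable phi x ->
  dR phi x = cos (ang x) *: 'D_e1 phi x + sin (ang x) *: 'D_e2 phi x.
Proof.
move=> x0 dphi; have [h1 h2] := unit_ang x0.
have r0 : rad x != 0 by rewrite gt_eqF ?rad_gt0.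
have e : rad x *: unitR x = x.
  rewrite [LHS](_ : _ = (rad x * (x.1 / rad x), rad x * (x.2 / rad x))) //.
  by rewrite ![rad x * _]mulrC !divfK // -surjective_pairing.
have dphi' : differentiable phi (rad x *: unitR x) by rewrite e.
have d1 : is_derive (rad x) 1 (fun r : R => r * (x.1 / rad x)) (cos (ang x)).
  by rewrite -h1; apply: is_derive_eq; rewrite scaler0 add0r /GRing.scale /= mulr1.
have d2 : is_derive (rad x) 1 (fun r : R => r * (x.2 / rad x)) (sin (ang x)).
  by rewrite -h2; apply: is_derive_eq; rewrite scaler0 add0r /GRing.scale /= mulr1.
have := @derive1_curve phi (fun r => r *: unitR x) (rad x) _ _ dphi' d1 d2.
by rewrite e.
Qed.

Let scale_rotate (V : lmodType R) (c a b : R) (A B : V) :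
  c *: (- a *: A + b *: B) = (c * b) *: B - (c * a) *: A.
Proof. by rewrite scalerDr scaleNr scalerN addrC 2!scalerA. Qed.

Lemma dtau_test phi x : x != 0 -> differentiable phi x ->
  dtau phi x = cos (ang x) *: 'D_e2 phi x - sin (ang x) *: 'D_e1 phi x.
Proof.
move=> x0 dphi; have [h1 h2] := unit_ang x0.
have r0 : rad x != 0 by rewrite gt_eqF ?rad_gt0.
have e : rot 0 x = x.
  by rewrite /rot cos0 sin0 !mul1r !mul0r subr0 add0r -surjective_pairing.
have dphi' : differentiable phi (rot 0 x) by rewrite e.
have d1 : is_derive (0 : R) 1 (fun t : R => cos t * x.1 - sin t * x.2) (- x.2).
  apply: is_derive_eq.
  by rewrite !scaler0 !add0r sin0 cos0 /GRing.scale /= oppr0 mulr0 mulr1 sub0r.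
have d2 : is_derive (0 : R) 1 (fun t : R => sin t * x.1 + cos t * x.2) x.1.
  apply: is_derive_eq.
  by rewrite !scaler0 !add0r sin0 cos0 /GRing.scale /= oppr0 mulr0 mulr1 addr0.
rewrite /dtau /dtheta (_ : derive1 _ 0 = - x.2 *: 'D_e1 phi x + x.1 *: 'D_e2 phi x); last first.
  have := @derive1_curve phi (fun t => rot t x) 0 _ _ dphi' d1 d2.
  by rewrite e.
have -> : cos (ang x) = (rad x)^-1 * x.1 by rewrite -h1 mulrC.
have -> : sin (ang x) = (rad x)^-1 * x.2 by rewrite -h2 mulrC.
exact: scale_rotate.
Qed.

(** Outside the disk a test function vanishes on a whole neighborhood, since its
    support is a closed subset of the disk; so its derivatives vanish as well. *)
Lemma test_C1 phi : test_function phi ->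
  [/\ forall x, differentiable phi x, continuous phi,
      continuous (fun x => 'D_e1 phi x), continuous (fun x => 'D_e2 phi x) &
      forall x, 1 <= rad x -> [/\ phi x = 0, 'D_e1 phi x = 0 & 'D_e2 phi x = 0]].
Proof.
move=> [kphi _ sphi]; have [dphi k1 k2] := kphi 1%N.
have kphi0 : continuous phi by move=> x; exact: differentiable_continuous.
suff z x : 1 <= rad x -> [/\ phi x = 0, 'D_e1 phi x = 0 & 'D_e2 phi x = 0].
  exact: And5 dphi kphi0 k1 k2 z.
move=> r1.
have nx : \forall y \near x, cst 0 y = phi y.
  have : (~` closure [set x | phi x != 0]) x.
    by move=> /sphi; rewrite /disk /= ltNge r1.
  have : open (~` closure [set x | phi x != 0]) by apply: closed_openC; exact: closed_closure.
  rewrite openE => /[apply]; rewrite /interior /=; apply: filterS => y /= yN.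
  by apply/esym; apply: contra_notP yN => /eqP yn; exact: subset_closure.
have dz (v : R * R) : 'D_v phi x = 0 by rewrite -(near_eq_derive v nx) derive_cst.
by split; [rewrite -(nbhs_singleton nx)|exact: dz|exact: dz].
Qed.

Lemma test_coord_C1 phi i : test_function phi ->
  C1_in_disk (fun x => phi x i 0) (fun x => 'D_e1 phi x i 0) (fun x => 'D_e2 phi x i 0).
Proof.
move=> /test_C1[dphi kphi k1 k2 z].
have der (v x : R * R) : is_derive x v (fun x => phi x i 0) ('D_v phi x i 0).
  have h : derivable phi x v by exact: diff_derivable.
  constructor; first exact: ((derivable_mxP phi x v).1 h i 0).
  by rewrite derive_mx // mxE.
have coord (F : R * R -> 'cV[R]_m) : continuous F -> continuous (fun x => F x i 0).
  move=> cF x.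
  apply: (@continuous_comp _ _ _ F (fun M : 'cV[R]_m => M i 0)); first exact: cF.
  exact: coord_continuous.
split; [by move=> x; exact: der|by move=> x; exact: der| |].
  by split; [exact: coord|exact: (coord _ k1)|exact: (coord _ k2)].
by move=> x /z[-> -> ->]; rewrite !mxE.
Qed.

Lemma dR0 phi : dR phi 0 = 0.
Proof.
rewrite /dR; have -> : (fun r => phi (r *: unitR 0)) = cst (phi (0, 0)).
  by apply/funext => r; rewrite /unitR /= !mul0r [_ *: _](_ : _ = (r *: (0 : R), r *: (0 : R))) // !scaler0.
by rewrite derive1_cst.
Qed.

Lemma dtau0 phi : dtau phi 0 = 0.
Proof. by rewrite /dtau /rad /= expr0n addr0 sqrtr0 invr0 scale0r. Qed.

(** The weak form has, with [Q = a g] and [P = a g'], the first two terms of this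
    sum. The third one is the term that makes it a divergence, so that comparing
    it with [- (Lambda g') . phi / R] gives the equation satisfied by [g]. *)
Definition polar_form (Q P P' : 'I_m -> R -> R) phi x : R :=
  \sum_i (Q i (ang x) * dR phi x i 0 + P i (ang x) * dtau phi x i 0 +
          (Q i (ang x) + P' i (ang x)) * ((rad x)^-1 * phi x i 0)).

Lemma rad0 : rad (0 : R * R) = 0.
Proof. by rewrite /rad /= expr0n addr0 sqrtr0. Qed.

Lemma polar_form0 Q P P' phi : polar_form Q P P' phi 0 = 0.
Proof.
by rewrite /polar_form big1 // => i _; rewrite dR0 dtau0 rad0 invr0 !mxE mul0r !mulr0 !addr0.
Qed.

Lemma polar_form_off Q P P' phi x : test_function phi -> 1 <= rad x ->
  polar_form Q P P' phi x = 0.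
Proof.
move=> /test_C1[dphi _ _ _ z] r1; have [z0 z1 z2] := z x r1.
have x0 : x != 0 by rewrite -rad_gt0 (lt_le_trans ltr01).
rewrite /polar_form big1 // => i _.
by rewrite dR_test // dtau_test // z0 z1 z2 !scaler0 subrr addr0 !mxE !mulr0 !addr0.
Qed.

Let lincombD (a b : R) (A B : 'cV[R]_m) i : (a *: A + b *: B) i 0 = a * A i 0 + b * B i 0.
Proof. by rewrite !mxE. Qed.

Let lincombB (a b : R) (A B : 'cV[R]_m) i : (a *: A - b *: B) i 0 = a * A i 0 - b * B i 0.
Proof. by rewrite !mxE. Qed.

Lemma polar_form_integral (Q Q' P P' : 'I_m -> R -> R) phi :
  (forall i, circular_C1 (Q i) (Q' i)) -> (forall i, circular_C1 (P i) (P' i)) ->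
  test_function phi ->
  mu2.-integrable (@disk R) (EFin \o polar_form Q P P' phi) /\
  (\int[mu2]_(x in @disk R) (polar_form Q P P' phi x)%:E = 0)%E.
Proof.
move=> hQ hP hphi.
have [dphi _ _ _ _] := test_C1 hphi.
pose I i x := Q i (ang x) * (cos (ang x) * 'D_e1 phi x i 0 + sin (ang x) * 'D_e2 phi x i 0) +
             P i (ang x) * (cos (ang x) * 'D_e2 phi x i 0 - sin (ang x) * 'D_e1 phi x i 0) +
             (Q i (ang x) + P' i (ang x)) * ((rad x)^-1 * phi x i 0).
have hI i := polar_divergence (test_coord_C1 i hphi) (hQ i) (hP i).
have hs : mu2.-integrable setT (EFin \o (fun x => \sum_i I i x)) /\
    (\int[mu2]_x (\sum_i I i x)%:E = 0)%E.
  have eE : EFin \o (fun x => \sum_i I i x) = (fun x => \sum_i (I i x)%:E)%E.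
    by apply/funext => x; rewrite /= sumEFin.
  split; first by rewrite eE; apply: integrable_sum => // i _; exact: (hI i).1.
  under eq_integral => x _ do rewrite [(_)%:E](congr1 (fun f => f x) eE).
  rewrite integral_sum //; last by move=> i; exact: (hI i).1.
  by apply: big1 => i _; exact: (hI i).2.
set J := polar_form Q P P' phi.
(* the factor [rad x / rad x] is 1 except at the origin, where it is 0 *)
have eJ : J = (fun x => (\sum_i I i x) * (rad x / rad x)).
  apply/funext => x; rewrite /J; have [->|x0] := eqVneq x 0.
    by rewrite polar_form0 rad0 mul0r mulr0.
  rewrite divff ?mulr1 ?gt_eqF ?rad_gt0 //; apply: eq_bigr => i _.
  by rewrite dR_test // dtau_test // lincombD lincombB.
have mJ : measurable_fun setT J.
  rewrite eJ; apply: measurable_funM.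
    by apply/measurable_EFinP; exact: measurable_int hs.1.
  have mr : measurable_fun setT (@rad R).
    by apply: continuous_measurable2; exact: rad_continuous.
  by apply: measurable_funM => //; apply: measurableT_comp => //; exact: measurable_inv.
have [iJ zJ] : mu2.-integrable setT (EFin \o J) /\ (\int[mu2]_x (J x)%:E = 0)%E.
  apply: (integral_off_axis mJ _ hs.1 hs.2) => x x1.
  rewrite eJ divff ?mulr1 ?gt_eqF ?rad_gt0 //.
  by apply: contra_neq x1 => ->.
split.
  by apply: integrableS iJ => //; exact: measurable_disk.
rewrite integral_mkcond -[RHS]zJ; apply: eq_integral => x _.
rewrite /patch; case: ifPn => //; rewrite notin_setE /disk /= => /negP; rewrite -leNgt => r1.
by rewrite /J polar_form_off.
Qed.

End Test.
End TestFunctions.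

(** * One-homogeneous maps *)

Section Homogeneous.
Context {R : realType}.
Variable m : nat.
Implicit Types (phi u : R * R -> 'cV[R]_m) (x : R * R).

Lemma enorm_sqr p n (F : 'M[R]_(p, n)) : enorm F ^+ 2 = mxdot F F.
Proof.
rewrite sqr_sqrtr // mxdotE; apply: sumr_ge0 => i _; apply: sumr_ge0 => j _.
by rewrite -expr2 sqr_ge0.
Qed.

Lemma enorm_ge0 p n (F : 'M[R]_(p, n)) : 0 <= enorm F.
Proof. exact: sqrtr_ge0. Qed.

Lemma enorm_gt0 p n (F : 'M[R]_(p, n)) : (0 < enorm F) = (F != 0).
Proof.
rewrite lt_def enorm_ge0 andbT; congr (~~ _).
rewrite -(sqrf_eq0 (enorm F)) enorm_sqr mxdotE; apply/eqP/eqP => [h|->]; last first.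
  by rewrite big1 // => i _; rewrite big1 // => j _; rewrite mxE mul0r.
have sq i j : 0 <= F i j * F i j by rewrite -expr2 sqr_ge0.
have h1 i : \sum_j F i j * F i j = 0.
  by apply: (psumr_eq0P _ h) => // k _; apply: sumr_ge0.
apply/matrixP => i j; rewrite mxE; apply/eqP; rewrite -sqrf_eq0 expr2; apply/eqP.
by apply: (psumr_eq0P _ (h1 i)).
Qed.

Lemma derive_enorm_line p n (F : 'M[R]_(p, n)) i j h :
  mxdot (h *: delta_mx i j + F) (h *: delta_mx i j + F) =
  mxdot F F + 2 * F i j * h + h ^+ 2.
Proof.
have dd (G : 'M[R]_(p, n)) : mxdot (delta_mx i j) G = G i j.
  rewrite mxdotE (bigD1 i) //= (bigD1 j) //= mxE !eqxx mul1r !big1 ?addr0 //.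
    by move=> k ki; rewrite big1 // => l _; rewrite mxE (negPf ki) mul0r.
  by move=> k kj; rewrite mxE (negPf kj) andbF mul0r.
rewrite !(mxdotDl, mxdotDr, mxdotZl, mxdotZr) dd mxE !eqxx mulr1.
by rewrite (mxdotC F) dd; ring.
Qed.

(** Along a coordinate direction [|F|^2] is a quadratic polynomial, so the chain
    rule in one variable is enough. At [F = 0] both sides are zero. *)
Lemma DgammaE (f : R -> R) (F : 'M[R]_(m, 2)) : derivable f (enorm F) 1 ->
  Dgamma f F = (derive1 f (enorm F) / enorm F) *: F.
Proof.
move=> df; rewrite /Dgamma; case: eqVneq => [->|F0]; first by rewrite scaler0.
have n0 : 0 < enorm F by rewrite enorm_gt0.
apply/matrixP => i j; rewrite !mxE.
pose q (h : R) := mxdot F F + 2 * F i j * h + h ^+ 2.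
have q0 : q 0 = enorm F ^+ 2 by rewrite enorm_sqr /q mulr0 expr0n !addr0.
have -> : 'D_(delta_mx i j) (gamma f) F = 'D_1 (f \o (Num.sqrt \o q)) 0.
  rewrite /derive (_ : (fun h : R => h^-1 *: (gamma f (h *: delta_mx i j + F) - gamma f F)) =
    (fun h : R => h^-1 *: ((f \o (Num.sqrt \o q)) (h *: (1 : R) + 0) - (f \o (Num.sqrt \o q)) 0))) //.
  apply/funext => h; congr (_ *: _).
  rewrite /= addr0 /gamma /enorm derive_enorm_line [h *: 1]mulr1; congr (_ - f (Num.sqrt _)).
  by rewrite -enorm_sqr q0.
have dq : is_derive (0 : R) 1 q (2 * F i j).
  apply: is_derive_eq.
  by rewrite /GRing.scale /=; ring.
have sq0 : Num.sqrt (q 0) = enorm F by rewrite q0 sqrtr_sqr ger0_norm // ltW.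
have ds : is_derive (q 0) 1 Num.sqrt (2 * Num.sqrt (q 0))^-1.
  by apply: is_derive1_sqrt; rewrite q0 exprn_gt0.
have dqs := is_derive1_comp ds dq.
have df' : is_derive ((Num.sqrt \o q) 0) 1 f (derive1 f (enorm F)).
  by rewrite /= sq0 derive1E; exact: derivableP.
have [_ ->] := is_derive1_comp df' dqs.
by rewrite sq0; field; rewrite gt_eqF.
Qed.

Lemma circular_profile u : circular (profile u).
Proof. by move=> a b; rewrite /profile => -> ->. Qed.

Lemma is_derive_mxP p n (V : normedModType R) (M : V -> 'M[R]_(p, n)) (D : 'M[R]_(p, n))
    (t v : V) :
  is_derive t v M D <-> forall i j, is_derive t v (fun s => M s i j) (D i j).
Proof.
split=> [[dM <-] i j|h].
  by constructor; [exact: ((derivable_mxP M t v).1 dM i j)|rewrite derive_mx // mxE].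
have dM : derivable M t v by apply/derivable_mxP => i j; case: (h i j).
by constructor=> //; rewrite derive_mx //; apply/matrixP => i j; rewrite mxE; case: (h i j).
Qed.

Lemma is_derive1E (V : normedModType R) (f : R -> V) (t : R) d :
  is_derive t 1 f d -> derive1 f t = d.
Proof. by move=> [_ <-]; rewrite derive1E. Qed.

(** On each ray [u] is linear. *)
Lemma dR_homog u x : one_homogeneous u -> x != 0 -> dR u x = profile u (ang x).
Proof.
move=> hu x0; have r0 : 0 < rad x by rewrite rad_gt0.
have [h1 h2] := unit_ang x0.
have nr : \forall r \near rad x, r *: profile u (ang x) = u (r *: unitR x).
  near=> r; have rp : 0 < r by near: r; exact: lt_nbhsr.
  rewrite /profile -hu.1 ?ltW //; congr u; congr (_ *: _).
  by rewrite /unitR h1 h2.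
rewrite /dR derive1E -(near_eq_derive (1 : R) nr).
apply: derive_val; apply/is_derive_mxP => i j.
have -> : (fun r : R => (r *: profile u (ang x)) i j) = (fun r : R => r * profile u (ang x) i j).
  by apply/funext => r; rewrite mxE.
by apply: is_derive_eq; rewrite scaler0 add0r /GRing.scale /= mulr1.
Unshelve. all: by end_near. Qed.

Lemma dtau_homog u x (d : 'cV[R]_m) : one_homogeneous u -> x != 0 ->
  is_derive (ang x) 1 (profile u) d -> dtau u x = d.
Proof.
move=> hu x0 /is_derive_mxP dg; have r0 : 0 < rad x by rewrite rad_gt0.
have [h1 h2] := ang_spec x.
suff h : is_derive (0 : R) 1 (fun t => u (rot t x)) (rad x *: d).
  by rewrite /dtau /dtheta (is_derive1E h) scalerA mulVf ?scale1r ?gt_eqF.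
apply/is_derive_mxP => i j; rewrite mxE.
have -> : (fun s : R => u (rot s x) i j) = (fun s : R => rad x * profile u (ang x + s) i j).
  apply/funext => s; rewrite [RHS](_ : _ = (rad x *: profile u (ang x + s)) i j); last by rewrite mxE.
  rewrite /profile -hu.1 ?ltW //.
  rewrite [X in _ = u X _ _](_ : _ = (rad x * cos (ang x + s), rad x * sin (ang x + s))) //.
  rewrite cosD sinD /rot; congr (u (_, _) _ _).
  - by rewrite h1 h2; ring.
  - by rewrite h1 h2; ring.
have ds : is_derive (0 : R) 1 (fun s : R => ang x + s) 1.
  by apply: is_derive_eq; rewrite add0r mulr1.
have dg' : is_derive (ang x + 0) 1 (fun t => profile u t i j) (d i j).
  by rewrite addr0; exact: dg.
have := is_derive1_comp dg' ds => dc.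
by apply: is_derive_eq; rewrite mulr1.
Qed.

Section WeakIntegrand.
Variables (f : R -> R) (Lambda : 'M[R]_m) (u phi : R * R -> 'cV[R]_m).
Variable dg : R -> 'cV[R]_m.
Hypotheses (hu : one_homogeneous u) (hdg : forall t : R, is_derive t 1 (profile u) (dg t)).

Lemma enorm_grad x : x != 0 ->
  enorm (grad u x) ^+ 2 = enorm (profile u (ang x)) ^+ 2 + enorm (dg (ang x)) ^+ 2.
Proof.
move=> x0; rewrite !enorm_sqr /grad (dR_homog hu x0) (dtau_homog hu x0 (hdg _)).
by rewrite mxdot_polar.
Qed.

(** [A] is [f'(|grad u|) / |grad u|]; the orthonormal frame decouples the radial
    and the angular terms. *)
Lemma weak_integrand_homog x A : x != 0 ->
  Dgamma f (grad u x) = A *: grad u x ->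
  weak_integrand f Lambda u phi x =
  \sum_i (A * profile u (ang x) i 0 * dR phi x i 0 + A * dg (ang x) i 0 * dtau phi x i 0
          - (Lambda *m dg (ang x)) i 0 * ((rad x)^-1 * phi x i 0)).
Proof.
move=> x0 hD; rewrite /weak_integrand hD mxdotZl /grad.
rewrite (dR_homog hu x0) (dtau_homog hu x0 (hdg _)) mxdot_polar // !mxdot_col.
rewrite -big_split mulr_sumr -sumrB; apply: eq_bigr => i _.
by rewrite /= [((rad x)^-1 *: phi x) i 0]mxE; ring.
Qed.

Lemma weak_integrand0 : weak_integrand f Lambda u phi 0 = 0.
Proof.
have gz : grad phi 0 = 0 by rewrite /grad dR0 dtau0 /tensor !mul0mx addr0.
by rewrite /weak_integrand gz rad0 invr0 scale0r /mxdot !mulmx0 !mxtrace0 subrr.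
Qed.

End WeakIntegrand.

End Homogeneous.

(** * Explicit solutions *)

Section Explicit.
Context {R : realType}.
Variable m : nat.

(** When [|grad u| = t] is constant, the coefficient [a = f'(t) / t] is constant
    and the weak form is linear in [g]. The differential equation says exactly that
    [a g + (a g')' = - Lambda g'], so the weak integrand is a divergence. *)
Lemma weak_solution_of_ode (f : R -> R) (Lambda : 'M[R]_m) (u : R * R -> 'cV[R]_m)
    (dg ddg : R -> 'cV[R]_m) (t : R) :
  one_homogeneous u -> 0 < t -> derivable f t 1 ->
  (forall s : R, is_derive s 1 (profile u) (dg s)) ->
  (forall s : R, is_derive s 1 dg (ddg s)) -> continuous ddg ->
  (forall s, enorm (profile u s) ^+ 2 + enorm (dg s) ^+ 2 = t ^+ 2) ->
  (forall s, (derive1 f t / t) *: (ddg s + profile u s) + Lambda *m dg s = 0) ->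
  weak_solution f Lambda u.
Proof.
move=> hu t0 df hdg hddg cddg ht ode phi hphi.
set a := derive1 f t / t.
have edg : derive1 (profile u) = dg by apply/funext => s; exact: is_derive1E.
have eddg : derive1 dg = ddg by apply/funext => s; exact: is_derive1E.
have coord (F : R -> 'cV[R]_m) i : continuous F -> continuous (fun s => F s i 0).
  move=> cF s; apply: (@continuous_comp _ _ _ F (fun M : 'cV[R]_m => M i 0)); first exact: cF.
  exact: coord_continuous.
have cont (F dF : R -> 'cV[R]_m) : (forall s : R, is_derive s 1 F (dF s)) -> continuous F.
  by move=> h s; apply/differentiable_continuous/derivable1_diffP; case: (h s).
have C1 (F dF : R -> 'cV[R]_m) i : circular F -> (forall s : R, is_derive s 1 F (dF s)) ->
    continuous dF -> circular_C1 (fun s => a * F s i 0) (fun s => a * dF s i 0).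
  move=> cF hF kF.
  have cdF : circular dF.
    have <- : derive1 F = dF by apply/funext => s; exact: is_derive1E.
    exact: circular_derive1.
  split.
  - by move=> p q e1 e2; rewrite (cF p q).
  - by move=> p q e1 e2; rewrite (cdF p q).
  - move=> s; have /is_derive_mxP /(_ i 0) h := hF s.
    by apply: is_derive_eq.
  - by move=> s; apply: cvgM; [exact: cvg_cst|exact: coord].
have cdg : circular dg by rewrite -edg; apply: circular_derive1; exact: circular_profile.
have [iJ zJ] := polar_form_integral
  (fun i => C1 _ _ i (@circular_profile _ _ u) hdg (cont _ _ hddg))
  (fun i => C1 _ _ i cdg hddg cddg) hphi.
have e x : weak_integrand f Lambda u phi x = polar_form
    (fun i s => a * profile u s i 0) (fun i s => a * dg s i 0) (fun i s => a * ddg s i 0) phi x.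
  have [->|x0] := eqVneq x 0; first by rewrite weak_integrand0 polar_form0.
  have ng : enorm (grad u x) = t.
    apply/eqP; rewrite -(eqrXn2 (n := 2)) ?enorm_ge0 ?(ltW t0) //.
    by rewrite (enorm_grad hu hdg x0) ht.
  rewrite (weak_integrand_homog (A := a) _ _ hu hdg x0); last first.
    by rewrite DgammaE ng.
  apply: eq_bigr => i _; have /matrixP /(_ i 0) := ode (ang x); rewrite !mxE -/a => h.
  have -> : a * profile u (ang x) i 0 + a * ddg (ang x) i 0 = - (\sum_j Lambda i j * dg (ang x) j 0).
    by apply/eqP; rewrite -addr_eq0 -mulrDr [_ i 0 + _]addrC h.
  by rewrite mulNr.
have ef : weak_integrand f Lambda u phi = polar_form
    (fun i s => a * profile u s i 0) (fun i s => a * dg s i 0) (fun i s => a * ddg s i 0) phi.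
  exact/funext.
by rewrite ef.
Qed.

(** The one-homogeneous extension of a function on the circle. *)
Definition homext (g : R -> 'cV[R]_m) (x : R * R) : 'cV[R]_m := rad x *: g (ang x).

Lemma rad_unit (t : R) : rad (cos t, sin t) = 1.
Proof. by rewrite /rad /= cos2Dsin2 sqrtr1. Qed.

Lemma profile_homext g : circular g -> profile (homext g) = g.
Proof.
move=> cg; apply/funext => t; rewrite /profile /homext rad_unit scale1r.
by have := circular_ang t cg (@ltr01 R); rewrite !mul1r.
Qed.

Lemma radZ l x : 0 <= l -> rad (l *: x) = l * rad (x : R * R).
Proof.
move=> l0; rewrite /rad [l *: x](_ : _ = (l * x.1, l * x.2)) // !exprMn -mulrDr.
by rewrite sqrtrM ?sqr_ge0 // sqrtr_sqr ger0_norm.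
Qed.

Lemma homext_homogeneous g : circular g -> lipschitz g -> one_homogeneous (homext g).
Proof.
move=> cg lg; split; last by rewrite profile_homext.
move=> l x l0; rewrite /homext radZ // -scalerA.
have [->|l1] := eqVneq l 0; first by rewrite !scale0r.
have [->|x0] := eqVneq x 0; first by rewrite rad0 !scale0r.
have lp : 0 < l by rewrite lt_def l1.
congr (_ *: (_ *: _)); have [h1 h2] := ang_spec x.
apply: circular_polar => //.
- by rewrite -rad_gt0 radZ // mulr_gt0 // rad_gt0.
- by rewrite radZ // -mulrA -h1.
- by rewrite radZ // -mulrA -h2.
Qed.

(** * Winding maps *)

(** An ellipse, run through [k] times. *)
Definition winding k (v w : 'cV[R]_m) (t : R) : 'cV[R]_m :=
  cos (k%:R * t) *: v + sin (k%:R * t) *: w.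

Lemma circular_mul k :
  circular (fun t : R => cos (k%:R * t)) /\ circular (fun t : R => sin (k%:R * t)).
Proof.
elim: k => [|k [hc hs]]; first by split=> a b _ _; rewrite !mul0r.
have e a : k.+1%:R * a = k%:R * a + a :> R by rewrite -natr1 mulrDl mul1r.
split=> a b h1 h2; rewrite !e ?cosD ?sinD (hc a b) // (hs a b) // h1 h2 //.
Qed.

Lemma circular_winding k v w : circular (winding k v w).
Proof.
have [hc hs] := circular_mul k.
by move=> a b h1 h2; rewrite /winding (hc a b) // (hs a b).
Qed.

Lemma lipschitz_cos_sin (a b : R) :
  `|cos a - cos b| <= `|a - b| /\ `|sin a - sin b| <= `|a - b|.
Proof.
wlog ba : a b / b <= a.
  move=> h; have [/h //|/ltW /h] := leP b a.
  by rewrite (distrC (cos a)) (distrC (sin a)) (distrC a).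
split.
- have [c _ ->] := MVT_segment ba (fun x _ => is_derive_cos x)
    (continuous_subspaceT (fun x => @continuous_cos R x)).
  by rewrite normrM normrN ler_piMl // sin_max.
- have [c _ ->] := MVT_segment ba (fun x _ => is_derive_sin x)
    (continuous_subspaceT (fun x => @continuous_sin R x)).
  by rewrite normrM ler_piMl // cos_max.
Qed.

Lemma lipschitz_winding k v w : lipschitz (winding k v w).
Proof.
exists (k%:R * (`|v| + `|w|)); split; first exact: num_real.
move=> M /ltW hM [a b] _ /=; apply: (@le_trans _ _ (k%:R * (`|v| + `|w|) * `|a - b|)); last first.
  exact: ler_wpM2r.
rewrite /winding opprD addrACA -!scalerBl (le_trans (ler_normD _ _)) // !normrZ.
have [h1 h2] := lipschitz_cos_sin (k%:R * a) (k%:R * b).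
move: h1 h2; rewrite -mulrBr normrM (ger0_norm (ler0n _ _)) => h1 h2.
rewrite [leRHS](_ : _ = k%:R * `|a - b| * `|v| + k%:R * `|a - b| * `|w|); last by ring.
by apply: lerD; exact: ler_wpM2r.
Qed.

Lemma is_derive_winding k v w (t : R) :
  is_derive t 1 (winding k v w) (winding k (k%:R *: w) (- k%:R *: v) t).
Proof.
apply/is_derive_mxP => i j; rewrite !mxE.
have -> : (fun s => winding k v w s i j) =
    (fun s : R => cos (k%:R * s) * v i j + sin (k%:R * s) * w i j).
  by apply/funext => s; rewrite !mxE.
have dk : is_derive t 1 (fun s : R => k%:R * s) k%:R.
  by apply: is_derive_eq; rewrite /GRing.scale /=; ring.
have dc := is_derive1_comp (is_derive_cos (k%:R * t)) dk.
have ds := is_derive1_comp (is_derive_sin (k%:R * t)) dk.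
apply: is_derive_eq; rewrite /GRing.scale /=.
by ring.
Qed.

Lemma continuous_winding k v w : continuous (winding k v w).
Proof.
move=> t; apply/differentiable_continuous/derivable1_diffP.
by case: (is_derive_winding k v w t).
Qed.

Lemma mxdot_winding k (v w : 'cV[R]_m) t (N : R) : mxdot v w = 0 ->
  mxdot v v = N -> mxdot w w = N -> mxdot (winding k v w t) (winding k v w t) = N.
Proof.
move=> vw vv ww; rewrite /winding !(mxdotDl, mxdotDr, mxdotZl, mxdotZr) (mxdotC w) vw vv ww.
have := cos2Dsin2 (k%:R * t); set c := cos _; set d := sin _ => h.
by rewrite -[RHS]mul1r -h; ring.
Qed.

(** The last two hypotheses are the coefficients of [cos (k s)] and of
    [sin (k s)] in the differential equation. *)
Lemma winding_solution (f : R -> R) (Lambda : 'M[R]_m) k v w t :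
  0 < t -> derivable f t 1 ->
  (forall s, enorm (winding k v w s) ^+ 2 +
             enorm (winding k (k%:R *: w) (- k%:R *: v) s) ^+ 2 = t ^+ 2) ->
  (derive1 f t / t * (1 - k%:R ^+ 2)) *: v + k%:R *: (Lambda *m w) = 0 ->
  (derive1 f t / t * (1 - k%:R ^+ 2)) *: w - k%:R *: (Lambda *m v) = 0 ->
  let u := homext (winding k v w) in
  one_homogeneous_solution f Lambda u /\ conservation_law (profile u) t.
Proof.
move=> t0 df ht h1 h2 u.
have cg : circular (winding k v w) by exact: circular_winding.
have eg : profile u = winding k v w by exact: profile_homext.
have hu : one_homogeneous u by apply: homext_homogeneous => //; exact: lipschitz_winding.
split; last first.
  rewrite eg; split; first exact: ltW.
    by move=> s; case: (is_derive_winding k v w s).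
  by move=> s; rewrite (is_derive1E (is_derive_winding k v w s)).
split=> //.
apply: (weak_solution_of_ode (dg := winding k (k%:R *: w) (- k%:R *: v)) (t := t)
  (ddg := winding k (k%:R *: (- k%:R *: v)) (- k%:R *: (k%:R *: w)))) => //.
- by rewrite eg => s; exact: is_derive_winding.
- by move=> s; exact: is_derive_winding.
- exact: continuous_winding.
- by rewrite eg.
move=> s; rewrite eg.
rewrite /winding; set c := cos _; set d := sin _; set a := derive1 f t / t in h1 h2 *.
have -> : a *: (c *: (k%:R *: (- k%:R *: v)) + d *: (- k%:R *: (k%:R *: w)) + (c *: v + d *: w))
   + Lambda *m (c *: (k%:R *: w) + d *: (- k%:R *: v)) =
   c *: ((a * (1 - k%:R ^+ 2)) *: v + k%:R *: (Lambda *m w)) +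
   d *: ((a * (1 - k%:R ^+ 2)) *: w - k%:R *: (Lambda *m v)).
  rewrite mulmxDr -!scalemxAr; apply/matrixP => i j; rewrite !mxE; ring.
by rewrite h1 h2 !scaler0 addr0.
Qed.

End Explicit.

(** * The image of a winding map and its covering number *)

Section Winding.
Context {R : realType}.
Variable m : nat.

Lemma cos_eq1_lt2pi (z : R) : 0 <= z < 2 * pi -> cos z = 1 -> z = 0.
Proof.
move=> /andP[z0 z2] cz; apply/eqP; rewrite eq_le z0 andbT leNgt; apply/negP => zp.
have s0 : 0 < sin (z / 2) by apply: sin_gt0_pi; lra.
have : cos (z / 2 *+ 2) = 1 by rewrite mulr2n (_ : z / 2 + z / 2 = z) //; field.
rewrite cos_mulr2n cos2sin2 => h.
have : sin (z / 2) ^+ 2 = 0 by move: h; rewrite mulr2n; lra.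
by move/eqP; rewrite sqrf_eq0 gt_eqF.
Qed.

Lemma cos_eq1_nat (z : R) : 0 <= z -> cos z = 1 -> exists n : nat, z = n%:R * (2 * pi).
Proof.
move=> z0 cz; have p2 : 0 < 2 * pi :> R by rewrite mulr_gt0 // pi_gt0.
have q0 : 0 <= z / (2 * pi) by rewrite divr_ge0 // ltW.
exists (Num.truncn (z / (2 * pi))); set n := Num.truncn _.
have /andP[n1 n2] := truncn_itv q0; rewrite -/n in n1 n2.
have : z - n%:R * (2 * pi) = 0; last by move/eqP; rewrite subr_eq0 => /eqP.
apply: cos_eq1_lt2pi.
  rewrite subr_ge0 -ler_pdivlMr // n1 /= ltrBlDr -[X in _ < X + _]mul1r -mulrDl -ltr_pdivrMr //.
  by rewrite addrC natr1.
rewrite -[RHS]cz -(periodicn (@cosD2pi R) n); congr cos.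
by rewrite -[pi *+ 2 *+ n]mulr_natl -[pi *+ 2]mulr_natl subrK.
Qed.

Variables (k : nat) (v w : 'cV[R]_m) (N : R).
Hypotheses (k2 : (2 <= k)%N) (N0 : 0 < N) (vw : mxdot v w = 0) (vv : mxdot v v = N)
  (ww : mxdot w w = N).

Let u := homext (winding k v w).

Let k0 : 0 < k%:R :> R. Proof. by rewrite ltr0n (leq_trans _ k2). Qed.

(** As [v] and [w] are orthogonal of the same length, [plane] is a similarity
    onto the plane that they span, and [u] is [plane] after the map that
    multiplies angles by [k]. *)
Definition plane (x : R * R) : 'cV[R]_m := x.1 *: v + x.2 *: w.
Definition plane_inv (y : 'cV[R]_m) : R * R := (mxdot v y / N, mxdot w y / N).

Lemma planeK : cancel plane plane_inv.
Proof.
move=> [a b]; rewrite /plane /plane_inv /=.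
rewrite !(mxdotDr, mxdotZr) vv ww vw (mxdotC w) vw !mulr0 addr0 add0r !mulfK ?gt_eqF //.
Qed.

Lemma u_plane x : u x = plane (rad x * cos (k%:R * ang x), rad x * sin (k%:R * ang x)).
Proof. by rewrite /u /homext /winding /plane scalerDr !scalerA. Qed.

Lemma rad_polar (r t : R) : 0 <= r -> rad (r * cos t, r * sin t) = r.
Proof.
by move=> r0; rewrite /rad /= !exprMn -mulrDr cos2Dsin2 mulr1 sqrtr_sqr ger0_norm.
Qed.

Lemma image_winding : u @` @disk R = plane @` @disk R.
Proof.
have ck := circular_mul k (R := R).
apply/seteqP; split => y [x xd <-].
  exists (rad x * cos (k%:R * ang x), rad x * sin (k%:R * ang x)); last by rewrite u_plane.
  by rewrite /disk /= rad_polar // rad_ge0.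
have [h1 h2] := ang_spec x.
have [x0|x0] := eqVneq x 0.
  exists 0; first by rewrite -x0.
  by rewrite u_plane rad0 !mul0r x0.
have r0 : 0 < rad x by rewrite rad_gt0.
exists (rad x * cos (ang x / k%:R), rad x * sin (ang x / k%:R)).
  by rewrite /disk /= rad_polar // ltW.
rewrite u_plane rad_polar ?rad_ge0 //.
rewrite (@circular_ang _ _ (fun t => cos (k%:R * t))) ?(@circular_ang _ _ (fun t => sin (k%:R * t))) //.
- by rewrite mulrCA divff ?gt_eqF // mulr1 -h1 -h2 -surjective_pairing.
- exact: ck.2.
- exact: ck.1.
Qed.

Lemma continuous_mxdot (a : 'cV[R]_m) : continuous (fun y : 'cV[R]_m => mxdot a y).
Proof.
have -> : (fun y : 'cV[R]_m => mxdot a y) = \sum_i (fun y : 'cV[R]_m => a i 0 * y i 0).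
  by apply/funext => y; rewrite mxdot_col fct_sumE.
apply: (big_ind (fun g : 'cV[R]_m -> R => continuous g)).
- exact: (@cst_continuous _ _ (0 : R)).
- by move=> g h cg ch y; apply: (@continuousD _ _ _ g h y (cg y) (ch y)).
- move=> i _ y.
  apply: (@continuousM _ _ (fun=> a i 0) (fun z : 'cV[R]_m => z i 0)); first exact: cst_continuous.
  exact: coord_continuous.
Qed.

Lemma winding_homeomorphic : homeomorphic (@disk R) (u @` @disk R).
Proof.
rewrite image_winding; exists plane, plane_inv; split=> //.
- apply: continuous_subspaceT => x; rewrite /plane.
  by apply: cvgD; apply: cvgZr_tmp; [exact: cvg_fst|exact: cvg_snd].
- apply: continuous_subspaceT => y.
  have c (a : 'cV[R]_m) : {for y, continuous (fun z => mxdot a z / N)}.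
    apply: (@continuousM _ _ (fun z => mxdot a z) (fun=> N^-1)); first exact: continuous_mxdot.
    exact: cst_continuous.
  exact: (@cvg_pair _ _ _ _ (nbhs (mxdot v y / N)) (nbhs (mxdot w y / N)) _ _ _ _ _ (c v) (c w)).
- apply/seteqP; split => [x [y [z zd <-] <-]|x xd]; first by rewrite planeK.
  by exists (plane x); [exists x|exact: planeK].
- by move=> x _; exact: planeK.
Qed.

Lemma winding_rad (x y : R * R) : u x = u y -> rad x = rad y.
Proof.
move=> /(congr1 plane_inv); rewrite !u_plane !planeK => -[h1 h2].
by rewrite -(rad_polar (k%:R * ang x) (rad_ge0 x)) h1 h2 rad_polar // rad_ge0.
Qed.

Let pi20 : 0 < 2 * pi :> R. Proof. by rewrite mulr_gt0 // pi_gt0. Qed.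

(** The difference of the two angles can be taken in [0, 2 pi]; multiplied by [k]
    it is a multiple [n] of [2 pi], with [n <= k], and [n = k] is a full turn. *)
Lemma winding_fiber_angle (x y : R * R) : x != 0 -> u x = u y ->
  exists2 j : nat, (j < k)%N &
    cos (ang x) = cos (ang y + j%:R * (2 * pi) / k%:R) /\
    sin (ang x) = sin (ang y + j%:R * (2 * pi) / k%:R).
Proof.
move=> x0 uxy; have exy := winding_rad uxy.
have r0 : rad x != 0 by rewrite gt_eqF // rad_gt0.
move: uxy => /(congr1 plane_inv); rewrite !u_plane !planeK -exy => -[/(mulfI r0) h1 /(mulfI r0) h2].
pose b := if ang y <= ang x then ang x - ang y else ang x - ang y + 2 * pi.
have [/andP[bx1 bx2] /andP[by1 by2]] := (ang_bound x, ang_bound y).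
have b0 : 0 <= b by rewrite /b; case: (leP (ang y) (ang x)) => ?; lra.
have b2 : b <= 2 * pi by rewrite /b; case: (leP (ang y) (ang x)) => ?; lra.
have eb : cos (ang y + b) = cos (ang x) /\ sin (ang y + b) = sin (ang x).
  rewrite /b; case: (leP (ang y) (ang x)) => _; first by rewrite addrC subrK.
  rewrite addrA [ang y + _]addrC subrK mulr_natl.
  by rewrite cosD2pi sinD2pi.
have kb0 : 0 <= k%:R * b by rewrite mulr_ge0 // ltW.
have [hc hs] := circular_mul k (R := R).
have ckb : cos (k%:R * b) = 1.
  have -> : k%:R * b = k%:R * (ang y + b) - k%:R * ang y by ring.
  by rewrite cosB (hc _ _ eb.1 eb.2) (hs _ _ eb.1 eb.2) h1 h2 -!expr2 cos2Dsin2.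
have [n en] := cos_eq1_nat kb0 ckb.
have ebn : b = n%:R * (2 * pi) / k%:R by rewrite -en mulrC mulKf // gt_eqF.
have nk : (n <= k)%N.
  by rewrite -(ler_nat R) -(ler_pM2r pi20) -en ler_pM2l.
move: nk; rewrite leq_eqVlt => /predU1P[nk|nk].
  exists 0%N; first exact: leq_trans k2.
  have eb2 : b = 2 * pi by rewrite ebn nk mulrC mulKf // gt_eqF.
  by rewrite !mul0r addr0 -eb.1 -eb.2 eb2 mulr_natl cosD2pi sinD2pi.
by exists n => //; rewrite -ebn eb.1 eb.2.
Qed.

(** The fiber consists of the [k] points of the circle of radius [rad y] whose
    angles differ from that of [y] by a multiple of [2 pi / k]. *)
Lemma winding_covered : covered_times u k.
Proof.
move=> _ [y yd <-] uy0.
have y0 : y != 0.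
  by apply: contra_neq uy0 => ->; rewrite u_plane rad0 !mul0r /plane /= !scale0r addr0.
have r0 : 0 < rad y by rewrite rad_gt0.
pose F (j : nat) : R * R := (rad y * cos (ang y + j%:R * (2 * pi) / k%:R),
  rad y * sin (ang y + j%:R * (2 * pi) / k%:R)).
have [hc hs] := circular_mul k (R := R).
have -> : @disk R `&` u @^-1` [set u y] = F @` `I_k.
  apply/seteqP; split => [x [xd /= uxy]|_ [j /= jk <-]].
    have exy := winding_rad uxy.
    have x0 : x != 0 by rewrite -rad_gt0 exy.
    have [j jk [e1 e2]] := winding_fiber_angle x0 uxy.
    exists j => //; rewrite /F -e1 -e2 -exy.
    by have [h1 h2] := ang_spec x; rewrite -h1 -h2 -surjective_pairing.
  split; first by rewrite /disk /= rad_polar ?rad_ge0.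
  rewrite /= !u_plane rad_polar ?rad_ge0 // /F.
  rewrite (circular_ang _ hc r0) (circular_ang _ hs r0).
  have -> : k%:R * (ang y + j%:R * (2 * pi) / k%:R) = k%:R * ang y + pi *+ 2 *+ j.
    by rewrite -[pi *+ 2 *+ j]mulr_natl -[pi *+ 2]mulr_natl; field; rewrite gt_eqF.
  by rewrite (periodicn (@cosD2pi R)) (periodicn (@sinD2pi R)).
apply: inj_card_eq => i j; rewrite !inE /= => ik jk [/(mulfI (lt0r_neq0 r0)) e1 /(mulfI (lt0r_neq0 r0)) e2].
wlog ij : i j ik jk e1 e2 / (i <= j)%N.
  move=> h; have [|/ltnW] := leqP i j; first exact: h.
  by move=> ji; apply/esym; apply: h.
have p0 : 0 <= ((j - i)%:R * (2 * pi) / k%:R : R) < 2 * pi.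
  apply/andP; split; first by rewrite divr_ge0 ?mulr_ge0 ?pi_ge0.
  rewrite ltr_pdivrMr // mulrC ltr_pM2l //.
  by rewrite ltr_nat (leq_ltn_trans (leq_subr _ _)).
have : (j - i)%:R * (2 * pi) / k%:R = 0 :> R.
  apply: cos_eq1_lt2pi => //.
  have -> : (j - i)%:R * (2 * pi) / k%:R = (ang y + j%:R * (2 * pi) / k%:R) -
     (ang y + i%:R * (2 * pi) / k%:R) by rewrite natrB //; ring.
  by rewrite cosB e1 e2 -!expr2 cos2Dsin2.
move/eqP; rewrite mulf_eq0 invr_eq0 (gt_eqF k0) orbF mulf_eq0 (gt_eqF pi20) orbF pnatr_eq0 subn_eq0 => ji.
by apply/eqP; rewrite eqn_leq ij.
Qed.

(** [|u|] is proportional to [rad], so a linear [u] would be one-to-one, against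
    the fibers having [k >= 2] points. *)
Lemma winding_nonlinear : ~ linear u.
Proof.
move=> lu; pose x0 : R * R := (2^-1, 0).
have r0 : rad x0 = 2^-1 by rewrite /rad /= expr0n addr0 sqrtr_sqr ger0_norm.
have u0 : u 0 = 0 by rewrite u_plane rad0 !mul0r /plane /= !scale0r addr0.
have x0d : @disk R x0 by rewrite /disk /= r0; lra.
have n0 : u x0 != 0.
  apply: contra_eq_neq r0 => /esym; rewrite -u0 => /winding_rad <-.
  by rewrite rad0 eq_sym invr_eq0 pnatr_eq0.
have := winding_covered (ex_intro2 _ _ _ x0d erefl) n0.
have -> : @disk R `&` u @^-1` [set u x0] = [set x0].
  apply/seteqP; split => [x [_ /= ux]|_ ->]; last by [].
  have : u ((-1) *: x0 + x) = u 0.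
    by rewrite lu ux u0 scaleN1r addNr.
  move=> /winding_rad; rewrite rad0 => rx.
  have : (-1) *: x0 + x == 0 by apply: contraTT isT; rewrite -rad_gt0 rx ltxx.
  by rewrite scaleN1r addrC subr_eq0 => /eqP.
move=> h1; have : ([set x0] #= `I_1)%card by exact: card_set1.
move=> /card_esym /card_eq_trans /(_ h1) /card_eq_II /eqP.
by rewrite ltn_eqF.
Qed.

End Winding.

(** * Existence of linear and of winding solutions *)

Section PartA.
Context {R : realType}.
Variables (m : nat) (Lambda : 'M[R]_m) (f : R -> R).
Hypothesis hanti : Lambda^T = - Lambda.
Hypothesis hf : forall t, 0 < t -> derivable f t 1.

Lemma mxdot_antisym (x y : 'cV[R]_m) : mxdot (Lambda *m x) y = - mxdot x (Lambda *m y).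
Proof.
by rewrite /mxdot trmx_mul hanti mulmxN mulNmx mulmxA linearN.
Qed.

Lemma mxdot_antisym0 (x : 'cV[R]_m) : mxdot x (Lambda *m x) = 0.
Proof.
apply/eqP; rewrite -[_ == 0](mulrn_eq0 _ 2) mulr2n -{1}[mxdot _ _]opprK -mxdot_antisym.
by rewrite mxdotC addNr.
Qed.

Lemma antisym_odd_kernel : odd m -> exists2 v : 'cV[R]_m, v != 0 & Lambda *m v = 0.
Proof.
move=> om; have d0 : \det Lambda = 0.
  have := det_tr Lambda; rewrite hanti -scaleN1r detZ -signr_odd om expr1 mulN1r => h.
  by apply/eqP; rewrite -[_ == 0](mulrn_eq0 _ 2) mulr2n -{1}h addNr.
have /eqP/det0P[v v0 vL] := d0.
exists v^T; first by rewrite trmx_eq0.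
by apply: trmx_inj; rewrite trmx_mul hanti trmxK mulmxN vL oppr0 trmx0.
Qed.

(** The solution is [x.1 *: v]: on the kernel of [Lambda] the lower order term
    disappears, and the gradient of a linear map is constant. *)
Lemma linear_solution (v : 'cV[R]_m) : v != 0 -> Lambda *m v = 0 ->
  exists u : R * R -> 'cV[R]_m,
    [/\ one_homogeneous_solution f Lambda u,
        exists c : R, conservation_law (profile u) c,
        linear u &
        exists x, u x != 0].
Proof.
move=> v0 Lv; pose u := homext (winding 1 v 0).
have eu x : u x = x.1 *: v.
  have [h1 _] := ang_spec x.
  by rewrite /u /homext /winding !mul1r scaler0 addr0 scalerA -h1.
have n0 : 0 < enorm v by rewrite enorm_gt0.
have [h1 h2] : one_homogeneous_solution f Lambda u /\ conservation_law (profile u) (enorm v).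
  apply: winding_solution => //; first exact: hf.
  - move=> s; rewrite /winding !mul1r !scaler0 addr0 add0r !enorm_sqr.
    rewrite !(mxdotZl, mxdotZr).
    have := cos2Dsin2 s; set c := cos s; set d := sin s => h.
    by transitivity ((c ^+ 2 + d ^+ 2) * mxdot v v); [ring|rewrite h mul1r].
  - by rewrite expr1n subrr mulr0 scale0r mulmx0 scaler0 addr0.
  - by rewrite Lv !scaler0 subrr.
exists u; split=> //; first by exists (enorm v).
  by move=> a x y; rewrite !eu /= scalerA -scalerDl.
by exists (1, 0); rewrite eu scale1r.
Qed.

(** Put [sg = (k^2 - 1) f'(t) / (k t)]. For an eigenvector [v] of [- Lambda^2] and
    [w = - Lambda v / sg], antisymmetry makes [v] and [w] orthogonal of equal
    length, and [Lambda] acts on their span as [sg] times a rotation by a right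
    angle, which is what the differential equation of [winding k v w] demands. *)
Lemma winding_solution_exists k t : (2 <= k)%N -> 0 < t ->
  let s := (((k%:R ^+ 2 - 1) * derive1 f t) / (k%:R * t)) ^+ 2 in
  s != 0 -> eigenvalue (- (Lambda *m Lambda)) s ->
  exists u : R * R -> 'cV[R]_m,
    [/\ one_homogeneous_solution f Lambda u,
        exists c : R, conservation_law (profile u) c,
        ~ linear u,
        homeomorphic (@disk R) (u @` @disk R) &
        covered_times u k].
Proof.
move=> k2 t0 s s0 /eigenvalueP[z hz z0].
set sg := ((k%:R ^+ 2 - 1) * derive1 f t) / (k%:R * t) in s s0 hz *.
have sg0 : sg != 0 by rewrite -sqrf_eq0.
have k0 : k%:R != 0 :> R by rewrite pnatr_eq0 -lt0n (leq_trans _ k2).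
have zn0 : 0 < enorm z^T by rewrite enorm_gt0 trmx_eq0.
have kk0 : 0 < 1 + k%:R ^+ 2 :> R by rewrite ltr_wpDr // sqr_ge0.
(* the length of v is chosen so that [|grad u|^2 = (1 + k^2) |v|^2 = t^2] *)
pose b := t / (Num.sqrt (1 + k%:R ^+ 2) * enorm z^T).
pose v := b *: z^T; pose w := - sg^-1 *: (Lambda *m v).
have LLv : Lambda *m (Lambda *m v) = - sg ^+ 2 *: v.
  rewrite [RHS](_ : _ = b *: (- sg ^+ 2 *: z^T)); last by rewrite !scalerA mulrC.
  rewrite /v -!scalemxAr mulmxA; congr (_ *: _).
  apply: trmx_inj; rewrite trmx_mul trmxK trmx_mul hanti mulmxN mulNmx opprK.
  by rewrite linearZ /= trmxK -[LHS]opprK -mulmxN hz scaleNr.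
have Lw : Lambda *m w = sg *: v.
  by rewrite /w -scalemxAr LLv scalerA mulNr mulrN opprK expr2 mulrA mulVf // mul1r.
have Lv : Lambda *m v = - sg *: w.
  by rewrite /w scalerA mulrNN divff // scale1r.
have vw : mxdot v w = 0 by rewrite /w mxdotZr mxdot_antisym0 mulr0.
pose N := t ^+ 2 / (1 + k%:R ^+ 2).
have vv : mxdot v v = N.
  rewrite /v mxdotZl mxdotZr -enorm_sqr /N mulrA -expr2 -exprMn /b invfM mulrA mulfVK ?gt_eqF //.
  by rewrite expr_div_n sqr_sqrtr // ltW.
have ww : mxdot w w = N.
  by rewrite {1}/w mxdotZl mxdot_antisym Lw mxdotZr vv mulNr mulrN opprK mulKf.
have N0 : 0 < N by rewrite divr_gt0 // exprn_gt0.
clearbody w v.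
have esg : derive1 f t / t * (1 - k%:R ^+ 2) = - (k%:R * sg).
  by rewrite /sg; field; rewrite k0 gt_eqF.
have [h1 h2] : one_homogeneous_solution f Lambda (homext (winding k v w)) /\
    conservation_law (profile (homext (winding k v w))) t.
  apply: winding_solution => //; first exact: hf.
  - move=> r; rewrite !enorm_sqr (mxdot_winding _ _ vw vv ww).
    have e1 : mxdot (k%:R *: w) (- k%:R *: v) = 0 by rewrite mxdotZl mxdotZr mxdotC vw !mulr0.
    have e2 : mxdot (k%:R *: w) (k%:R *: w) = k%:R ^+ 2 * N by rewrite mxdotZl mxdotZr ww mulrA expr2.
    have e3 : mxdot (- k%:R *: v) (- k%:R *: v) = k%:R ^+ 2 * N.
      by rewrite mxdotZl mxdotZr vv mulrA mulrNN expr2.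
    by rewrite (mxdot_winding _ _ e1 e2 e3) /N; field; rewrite gt_eqF.
  - by rewrite esg Lw scalerA scaleNr addNr.
  - by rewrite esg Lv scalerA mulrN subrr.
exists (homext (winding k v w)); split=> //; first by exists t.
- exact: (winding_nonlinear k2 N0 vw vv ww).
- exact: (winding_homeomorphic k2 N0 vw vv ww).
- exact: (winding_covered k2 N0 vw vv ww).
Qed.

End PartA.

(** * Bump functions *)

Section Bump.
Context {R : realType}.

(** The function [p(1/t) exp(-1/t)] extended by zero. Letting [p] vary makes this
    family closed under derivatives. *)
Definition flat (p : {poly R}) (t : R) : R := if 0 < t then p.[t^-1] * expR (- t^-1) else 0.

Lemma poly_bound (p : {poly R}) : exists2 C, 0 <= C &
  forall y, 1 <= y -> `|p.[y]| <= C * y ^+ size p.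
Proof.
exists (\sum_(i < size p) `|p`_i|); first by apply: sumr_ge0.
move=> y y1; rewrite horner_coef (le_trans (ler_norm_sum _ _ _)) // mulr_suml.
apply: ler_sum => i _; rewrite normrM ler_wpM2l // ger0_norm ?exprn_ge0 ?(le_trans ler01) //.
by rewrite ler_weXn2l // ltnW.
Qed.

(** The exponential beats every power; the square is what makes [flat p]
    differentiable at [0] with derivative [0]. *)
Lemma flat_bound p : exists2 C, 0 <= C & forall t, t <= 1 -> `|flat p t| <= C * t ^+ 2.
Proof.
have [C C0 hC] := poly_bound p; set n := size p in hC.
exists (C * (n.+2)`!%:R); first by rewrite mulr_ge0.
move=> t t1; rewrite /flat; case: ifPn => [t0|_]; last first.
  by rewrite normr0 mulr_ge0 ?sqr_ge0 // mulr_ge0.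
have y1 : 1 <= t^-1 by rewrite invf_ge1.
have y0 : 0 < t^-1 by rewrite invr_gt0.
rewrite normrM [`|expR _|]ger0_norm ?expR_ge0 // expRN.
rewrite ler_pdivrMr ?expR_gt0 // (le_trans (hC _ y1)) //.
have -> : C * n.+2`!%:R * t ^+ 2 * expR t^-1 = C * (n.+2`!%:R * (t ^+ 2 * expR t^-1)).
  by rewrite !mulrA.
rewrite ler_wpM2l //.
have h := expR_ge1Dxn n.+1 (ltW y0).
have h2 : t^-1 ^+ n.+2 / n.+2`!%:R <= expR t^-1 by apply: le_trans h; rewrite lerDr.
have -> : t^-1 ^+ n = n.+2`!%:R * (t ^+ 2 * (t^-1 ^+ n.+2 / n.+2`!%:R)).
  have fn0 : n.+2`!%:R != 0 :> R by rewrite pnatr_eq0 -lt0n fact_gt0.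
  have tn0 : t != 0 by rewrite gt_eqF.
  move: fn0; move: (n.+2`!%:R) => F F0.
  by rewrite -[n.+2]addn2 exprD !exprVn; field; rewrite ?F0 ?tn0 ?expf_neq0.
by rewrite ler_wpM2l // ler_wpM2l // sqr_ge0.
Qed.

Definition dflat (p : {poly R}) : {poly R} := 'X^2 * (p - p^`()).

Lemma is_derive_flat p (t : R) : is_derive t 1 (flat p) (flat (dflat p) t).
Proof.
have [t0|t0|<-] := ltgtP 0 t.
- have n : \forall s \near t, p.[s^-1] * expR (- s^-1) = flat p s.
    by near=> s; rewrite /flat ifT //; near: s; exact: lt_nbhsr.
  apply: (near_eq_is_derive n).
  have tn0 : t != 0 by rewrite gt_eqF.
  have di : is_derive t 1 (fun s : R => s^-1) (- t ^- 2).
    have := is_deriveV (f := id) tn0 (is_derive_id t 1).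
    by rewrite /GRing.scale /= mulr1.
  have dp : is_derive t^-1 1 (horner p) p^`().[t^-1].
    constructor; first exact: derivable_horner.
    by rewrite derivE derive1E.
  have dpi := is_derive1_comp dp di.
  have dn : is_derive t 1 (fun s : R => - s^-1) (t ^- 2).
    by have := is_deriveN di; rewrite opprK.
  have de := is_derive1_comp (g := fun s : R => - s^-1) (is_derive_expR (- t^-1)) dn.
  apply: is_derive_eq; rewrite /flat t0 /dflat !hornerE /GRing.scale /=; field.
  by [].
- have n : \forall s \near t, cst 0 s = flat p s.
    near=> s; rewrite /flat ifF //; apply/negbTE; rewrite -leNgt ltW //.
    by near: s; exact: lt_nbhsl.
  by apply: (near_eq_is_derive n); rewrite /flat ltNge (ltW t0) /=; exact: is_derive_cst.
- have [C C0 hC] := flat_bound p.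
  have f0 q : flat q 0 = 0 by rewrite /flat ltxx.
  have lim0 : (fun h : R => h^-1 *: (flat p (h *: (1 : R) + 0) - flat p 0)) @ 0^' --> (0 : R).
    apply/cvgrPdist_le => e e0; near=> h.
    rewrite sub0r normrN f0 subr0 addr0 [h *: 1]mulr1 normrM normfV.
    have hn0 : h != 0 by near: h; exact: nbhs_dnbhs_neq.
    have h1 : `|h| <= 1 by near: h; apply: dnbhs0_le.
    have h2 : `|h| <= e / (C + 1) by near: h; apply: dnbhs0_le; rewrite divr_gt0 // ltr_wpDl.
    rewrite mulrC ler_pdivrMr ?normr_gt0 // (le_trans (hC _ _)).
    + by [].
    + exact: le_trans (ler_norm _) h1.
    + rewrite -real_normK ?num_real // expr2 mulrA ler_pM2r ?normr_gt0 //.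
      rewrite (le_trans (ler_wpM2l C0 h2)) // mulrA ler_pdivrMr ?ltr_wpDl // mulrC ler_wpM2l ?(ltW e0) //.
      by rewrite lerDl.
  by rewrite f0; constructor; [apply/cvg_ex; exists 0|exact: cvg_lim].
Unshelve. all: by end_near. Qed.


Fixpoint smooth1 (k : nat) (b : R -> R) : Prop :=
  if k is k'.+1 then
    exists2 d, forall t : R, is_derive t 1 b (d t) & smooth1 k' d
  else continuous b.

Lemma smooth1W k b : smooth1 k.+1 b -> smooth1 k b.
Proof.
elim: k b => [|k IH] b [d db]; last by move=> /IH sd; exists d.
by move=> _ t; exact: is_derive_continuous (db t).
Qed.

Lemma smooth1D k b c : smooth1 k b -> smooth1 k c -> smooth1 k (fun t => b t + c t).
Proof.
elim: k b c => [|k IH] b c /=; first by move=> cb cc t; apply: cvgD; [exact: cb|exact: cc].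
move=> [b' db sb] [c' dc sc]; exists (fun t => b' t + c' t); last exact: IH.
by move=> t; have ? := db t; have ? := dc t; apply: is_derive_eq.
Qed.

Lemma smooth1M k b c : smooth1 k b -> smooth1 k c -> smooth1 k (fun t => b t * c t).
Proof.
elim: k b c => [|k IH] b c; first by move=> cb cc t; apply: cvgM; [exact: cb|exact: cc].
move=> sb sc; have [b' db sb'] := sb; have [c' dc sc'] := sc.
exists (fun t => b' t * c t + b t * c' t).
  move=> t; have ? := db t; have ? := dc t; apply: is_derive_eq.
  by rewrite /GRing.scale /= addrC; congr (_ + _); rewrite mulrC.
by apply: smooth1D; apply: IH => //; exact: smooth1W.
Qed.

(** The factor [c] is there for the induction: derivatives multiply it by [s]. *)
Lemma smooth1_affine k b (c s r : R) : smooth1 k b -> smooth1 k (fun t => c * b (s * t + r)).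
Proof.
elim: k b c => [|k IH] b c.
  move=> cb t; apply: (@continuousM _ _ (fun=> c) (fun t => b (s * t + r))).
    exact: cst_continuous.
  apply: (@continuous_comp _ _ _ (fun t => s * t + r) b); last exact: cb.
  apply: (@continuousD _ _ _ (fun t : R => s * t) (fun=> r)); last exact: cst_continuous.
  exact: mulrl_continuous.
move=> [d db sd]; exists (fun t => c * s * d (s * t + r)); last exact: IH.
move=> t; have da : is_derive t 1 (fun t : R => s * t + r) s.
  by apply: is_derive_eq; rewrite /GRing.scale /=; ring.
have dba := is_derive1_comp (g := fun t : R => s * t + r) (db (s * t + r)) da.
by apply: is_derive_eq; rewrite /GRing.scale /=; ring.
Qed.

Lemma smooth1_flat k p : smooth1 k (flat p).
Proof.
elim: k p => [|k IH] p; first by move=> t; exact: is_derive_continuous (is_derive_flat p t).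
by exists (flat (dflat p)); [exact: is_derive_flat|exact: IH].
Qed.

Definition bump (a b t : R) : R := flat 1 (t - a) * flat 1 (b - t).

Lemma smooth1_bump k a b : smooth1 k (bump a b).
Proof.
have -> : bump a b = (fun t => (1 * flat 1 (1 * t + - a)) * (1 * flat 1 (- 1 * t + b))).
  by apply/funext => t; rewrite !mul1r mulN1r [- t + b]addrC.
by apply: smooth1M; apply: smooth1_affine; exact: smooth1_flat.
Qed.

Lemma flat1_gt0 t : 0 < t -> 0 < flat 1 t.
Proof. by move=> t0; rewrite /flat t0 hornerC mul1r expR_gt0. Qed.

Lemma bump_gt0 a b t : a < t < b -> 0 < bump a b t.
Proof.
by move=> /andP[at_ tb]; rewrite mulr_gt0 // flat1_gt0 // subr_gt0.
Qed.

Lemma bump_off a b t : ~~ (a < t < b) -> bump a b t = 0.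
Proof.
rewrite negb_and /bump /flat !subr_gt0 => /orP[/negbTE ->|/negbTE ->]; first by rewrite mul0r.
by rewrite mulr0.
Qed.

Section Product.
Variable m : nat.

Definition bump2 (a1 b1 a2 b2 : R) (e : 'cV[R]_m) (x : R * R) : 'cV[R]_m :=
  (bump a1 b1 x.1 * bump a2 b2 x.2) *: e.

(** Both partial derivatives of a product of functions of one variable are again
    such products. *)
Lemma Ck_product k (b c : R -> R) (e : 'cV[R]_m) :
  smooth1 k b -> smooth1 k c -> Ck k (fun x : R * R => (b x.1 * c x.2) *: e).
Proof.
elim: k b c => [|k IH] b c.
  move=> cb cc x; apply: cvgZr_tmp; apply: cvgM.
    by apply: (@continuous_comp _ _ _ fst b); [exact: cvg_fst|exact: cb].
  by apply: (@continuous_comp _ _ _ snd c); [exact: cvg_snd|exact: cc].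
move=> sb sc; have [b' db sb'] := sb; have [c' dc sc'] := sc.
have D1 : (fun x : R * R => 'D_((1, 0) : R * R) (fun x : R * R => (b x.1 * c x.2) *: e) x) =
    (fun x => (b' x.1 * c x.2) *: e).
  apply/funext => -[t y] /=.
  have [_ ->] // : is_derive ((t, y) : R * R) ((1, 0) : R * R)
    (fun x : R * R => (b x.1 * c x.2) *: e) ((b' t * c y) *: e).
  apply/is_derive_hline/is_derive_mxP => i j /=; rewrite mxE.
  under [F in is_derive _ _ F _]eq_fun do rewrite mxE.
  have ? := db t; apply: is_derive_eq.
  by rewrite /GRing.scale /=; ring.
have D2 : (fun x : R * R => 'D_((0, 1) : R * R) (fun x : R * R => (b x.1 * c x.2) *: e) x) =
    (fun x => (b x.1 * c' x.2) *: e).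
  apply/funext => -[t y] /=.
  have [_ ->] // : is_derive ((t, y) : R * R) ((0, 1) : R * R)
    (fun x : R * R => (b x.1 * c x.2) *: e) ((b t * c' y) *: e).
  apply/is_derive_vline/is_derive_mxP => i j /=; rewrite mxE.
  under [F in is_derive _ _ F _]eq_fun do rewrite mxE.
  have ? := dc y; apply: is_derive_eq.
  by rewrite /GRing.scale /=; ring.
split.
- move=> x; apply: differentiableZl; apply: differentiableM.
    apply: (@differentiable_comp _ _ _ _ fst b).
      by apply: linear_differentiable => ?; exact: cvg_fst.
    by apply/derivable1_diffP; case: (db x.1).
  apply: (@differentiable_comp _ _ _ _ snd c).
    by apply: linear_differentiable => ?; exact: cvg_snd.
  by apply/derivable1_diffP; case: (dc x.2).
- by rewrite D1; apply: IH => //; exact: smooth1W.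
- by rewrite D2; apply: IH => //; exact: smooth1W.
Qed.

Lemma test_function_bump2 a1 b1 a2 b2 e :
  (forall x : R * R, a1 <= x.1 <= b1 -> a2 <= x.2 <= b2 -> rad x < 1) ->
  test_function (bump2 a1 b1 a2 b2 e).
Proof.
move=> hB.
pose K : set (R * R) := `[a1, b1]%classic `*` `[a2, b2]%classic.
have cK : compact K by apply: compact_setX; exact: segment_compact.
have sK : closure [set x | bump2 a1 b1 a2 b2 e x != 0] `<=` K.
  have /closure_id -> : closed K by apply: compact_closed => //; exact: norm_hausdorff.
  apply: closureS => x /=; apply: contra_neqP => xK.
  rewrite /bump2; have [h1|/bump_off ->] := boolP (a1 < x.1 < b1); last by rewrite mul0r scale0r.
  have [h2|/bump_off ->] := boolP (a2 < x.2 < b2); last by rewrite mulr0 scale0r.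
  by case: xK; split; rewrite /= in_itv /=; [case/andP: h1|case/andP: h2] => /ltW -> /ltW ->.
split.
- by move=> k; apply: Ck_product; exact: smooth1_bump.
- by apply: subclosed_compact cK sK; exact: closed_closure.
- by move=> x /sK[] /=; rewrite !in_itv /=; exact: hB.
Qed.

End Product.
End Bump.

(** * Stationarity of one-homogeneous solutions in the angular variable *)

Section Glue.
Context {R : realType}.

(** A C1 extension of [F] from [s0, +oo[ to the line, by its tangent at [s0]. It
    serves to make [f'(|grad u|) / |grad u|] a C1 function of the angle even where
    [grad u] may vanish. *)
Definition affine_below (F F' : R -> R) (s0 s : R) : R :=
  if s < s0 then F s0 + F' s0 * (s - s0) else F s.

(** At [s0] the difference quotients are those of [F] or exactly [F' s0]. *)
Lemma is_derive_affine_below (F F' : R -> R) (s0 s : R) :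
  (forall r : R, s0 <= r -> is_derive r 1 F (F' r)) ->
  is_derive s 1 (affine_below F F' s0) (F' (Num.max s s0)).
Proof.
move=> dF; have [lt|gt|->] := ltgtP s s0.
- have n : \forall r \near s, F s0 + F' s0 * (r - s0) = affine_below F F' s0 r.
    by near=> r; rewrite /affine_below ifT //; near: r; exact: lt_nbhsl.
  apply: (near_eq_is_derive n).
  by apply: is_derive_eq; rewrite /GRing.scale /=; ring.
- have n : \forall r \near s, F r = affine_below F F' s0 r.
    near=> r; rewrite /affine_below ifF //; apply/negbTE; rewrite -leNgt ltW //.
    by near: r; exact: lt_nbhsr.
  by apply: (near_eq_is_derive n); apply: dF; exact: ltW.
have [dFs0 eFs0] := dF s0 (lexx _).
have l : (fun h : R => h^-1 *: (affine_below F F' s0 (h *: (1 : R) + s0) - affine_below F F' s0 s0))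
    @ 0^' --> F' s0.
  have l0 : (fun h : R => h^-1 *: (F (h *: (1 : R) + s0) - F s0)) @ 0^' --> F' s0.
    by rewrite -eFs0; exact: dFs0.
  apply/cvgrPdist_le => e e0; near=> h.
  have hn0 : h != 0 by near: h; exact: nbhs_dnbhs_neq.
  rewrite {2}/affine_below ltxx /affine_below; case: ifPn => _; last first.
    by near: h; move/cvgrPdist_le : l0; apply.
  have -> : F s0 + F' s0 * (h *: (1 : R) + s0 - s0) - F s0 = F' s0 * h.
    by rewrite [h *: 1]mulr1; ring.
  rewrite /GRing.scale /= mulrCA mulVf // mulr1 subrr normr0.
  exact: ltW.
by constructor; [apply/cvg_ex; exists (F' s0)|exact: cvg_lim].
Unshelve. all: by end_near. Qed.

Lemma continuous_comp_max (F' : R -> R) (s0 : R) :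
  (forall r, s0 <= r -> {for r, continuous F'}) ->
  continuous (fun s => F' (Num.max s s0)).
Proof.
move=> cF s; apply: (@continuous_comp _ _ _ (fun s => Num.max s s0) F'); last first.
  by apply: cF; rewrite le_max lexx orbT.
have -> : (fun s => Num.max s s0) = (fun s => (s + s0 + `|s - s0|) / 2).
  by apply/funext => r; rewrite maxr_absE.
apply: (@continuousM _ _ (fun s => s + s0 + `|s - s0|) (fun=> 2^-1)); last exact: cst_continuous.
by apply: cvgD; [apply: cvgD; [exact: cvg_id|exact: cvg_cst]|
  apply: cvg_norm; apply: cvgB; [exact: cvg_id|exact: cvg_cst]].
Qed.

(** Off the half-line where it jumps, [ang] is locally continuous; near that
    half-line [vang] may be used in its place. *)
Lemma continuous_circular_ang (W : R -> R) (x : R * R) :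
  circular W -> continuous W -> x != 0 -> {for x, continuous (W \o @ang R)}.
Proof.
move=> cW kW x0.
have q1 : x.2 != 0 -> {for x, continuous (fun y : R * R => atan (y.1 / y.2))}.
  move=> x2; apply: (@continuous_comp _ _ _ (fun y : R * R => y.1 / y.2)); last exact: continuous_atan.
  by apply: cvgM; [exact: cvg_fst|apply: cvgV => //; exact: cvg_snd].
have q2 : x.1 != 0 -> {for x, continuous (fun y : R * R => atan (y.2 / y.1))}.
  move=> x1; apply: (@continuous_comp _ _ _ (fun y : R * R => y.2 / y.1)); last exact: continuous_atan.
  by apply: cvgM; [exact: cvg_snd|apply: cvgV => //; exact: cvg_fst].
have fstx (A : set R) : nbhs x.1 A -> \forall y \near x, A y.1.
  have h : {for x, continuous (@fst R R)} by exact: cvg_fst.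
  exact: h.
have sndx (A : set R) : nbhs x.2 A -> \forall y \near x, A y.2.
  have h : {for x, continuous (@snd R R)} by exact: cvg_snd.
  exact: h.
(* an angle may be replaced locally by any other angle that is continuous *)
have key (th : R * R -> R) : {for x, continuous th} ->
    (\forall y \near x, W (th y) = W (ang y)) -> {for x, continuous (W \o @ang R)}.
  move=> cth n; have : {for x, continuous (W \o th)}.
    by apply: continuous_comp => //; exact: kW.
  rewrite /prop_for /continuous_at /= (nbhs_singleton n); apply: cvg_trans.
  exact: near_eq_cvg.
have sub c (th : R * R -> R) : {for x, continuous th} -> {for x, continuous (fun y => c - th y)}.
  by move=> h; apply: cvgB; [exact: cvg_cst|exact: h].
have [x2|x2|x2] := ltgtP 0 x.2.
- apply: (key (fun y => pi / 2 - atan (y.1 / y.2))); first by apply/sub/q1; rewrite gt_eqF.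
  near=> y; rewrite /ang ifT //; near: y.
  exact: (sndx [set r | 0 < r]) (lt_nbhsr x2).
- apply: (key (fun y => - (pi / 2) - atan (y.1 / y.2))); first by apply/sub/q1; rewrite lt_eqF.
  near=> y; have y2 : y.2 < 0 by near: y; exact: (sndx [set r | r < 0]) (lt_nbhsl x2).
  by rewrite /ang ltNge (ltW y2) /= y2.
have x1 : x.1 != 0.
  by apply: contra_neq x0 => x1; rewrite [x]surjective_pairing x1 -x2.
have [x1p|x1n|x1e] := ltgtP 0 x.1; last by rewrite -x1e eqxx in x1.
- apply: (key (fun y => atan (y.2 / y.1) + 0)).
    by apply: cvgD; [exact: q2|exact: cvg_cst].
  near=> y; have y1 : 0 < y.1 by near: y; exact: (fstx [set r | 0 < r]) (lt_nbhsr x1p).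
  by rewrite (circular_vang cW) ?gt_eqF // /vang y1.
- apply: (key (fun y => atan (y.2 / y.1) + pi)).
    by apply: cvgD; [exact: q2|exact: cvg_cst].
  near=> y; have y1 : y.1 < 0 by near: y; exact: (fstx [set r | r < 0]) (lt_nbhsl x1n).
  by rewrite (circular_vang cW) ?lt_eqF // /vang ltNge (ltW y1).
Unshelve. all: by end_near. Qed.

End Glue.

Section Local.
Context {R : realType}.
Variables (m : nat) (f : R -> R) (Lambda : 'M[R]_m) (u : R * R -> 'cV[R]_m).
Variables (dg ddg : R -> 'cV[R]_m) (F F' : R -> R).

Local Notation mu2 := (@lebesgue_measure R \x @lebesgue_measure R)%E.
Local Notation T2 := (measurableTypeR R * measurableTypeR R)%type.
Local Notation g := (profile u).

Hypotheses (hu : one_homogeneous u) (hsol : weak_solution f Lambda u).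
Hypotheses (hdg : forall t : R, is_derive t 1 g (dg t))
  (hddg : forall t : R, is_derive t 1 dg (ddg t)) (cddg : continuous ddg).
Hypotheses (hf : forall t, 0 < t -> derivable f t 1)
  (hF : forall s, 0 < s -> F s = derive1 f (Num.sqrt s) / Num.sqrt s)
  (dF : forall s : R, 0 < s -> is_derive s 1 F (F' s))
  (cF' : forall s, 0 < s -> {for s, continuous F'}).

(** [|grad u|^2], a function of the angle alone. *)
Definition energy t : R := enorm (g t) ^+ 2 + enorm (dg t) ^+ 2.
Definition denergy t : R := 2 * mxdot (dg t) (g t + ddg t).

Let coord (G : R -> 'cV[R]_m) i : continuous G -> continuous (fun s => G s i 0).
Proof.
move=> cG s; apply: (@continuous_comp _ _ _ G (fun M : 'cV[R]_m => M i 0)); first exact: cG.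
exact: coord_continuous.
Qed.

Let cont (G dG : R -> 'cV[R]_m) : (forall s : R, is_derive s 1 G (dG s)) -> continuous G.
Proof. by move=> h s; apply/differentiable_continuous/derivable1_diffP; case: (h s). Qed.

Let cg : continuous g. Proof. exact: cont hdg. Qed.
Let cdg : continuous dg. Proof. exact: cont hddg. Qed.

Let circ_dg : circular dg.
Proof.
have <- : derive1 g = dg by apply/funext => s; exact: is_derive1E.
exact: circular_derive1 (@circular_profile _ _ u).
Qed.

Let circ_ddg : circular ddg.
Proof.
have <- : derive1 dg = ddg by apply/funext => s; exact: is_derive1E.
exact: circular_derive1 circ_dg.
Qed.

Let circ_g : circular g := @circular_profile _ _ u.

Lemma is_derive_energy (t : R) : is_derive t 1 energy (denergy t).
Proof.
have -> : energy = \sum_i (fun s => g s i 0 ^+ 2 + dg s i 0 ^+ 2).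
  apply/funext => s; rewrite /energy !enorm_sqr !mxdot_col -big_split fct_sumE /=.
  by apply: eq_bigr => i _; rewrite !expr2.
have -> : denergy t = \sum_i (2 * g t i 0 * dg t i 0 + 2 * dg t i 0 * ddg t i 0).
  rewrite /denergy mxdot_col mulr_sumr; apply: eq_bigr => i _; rewrite mxE; ring.
apply: is_derive_sum => i.
have /is_derive_mxP /(_ i 0) ? := hdg t; have /is_derive_mxP /(_ i 0) ? := hddg t.
apply: is_derive_eq; rewrite /GRing.scale /=.
by rewrite !mulr2n; ring.
Qed.

Let continuous_mxdot2 (G G1 : R -> 'cV[R]_m) : continuous G -> continuous G1 ->
  continuous (fun t => mxdot (G t) (G1 t)).
Proof.
move=> cG cG1.
have -> : (fun t => mxdot (G t) (G1 t)) = \sum_i (fun t => G t i 0 * G1 t i 0).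
  by apply/funext => y; rewrite mxdot_col fct_sumE.
apply: (big_ind (fun h : R -> R => continuous h)).
- exact: (@cst_continuous _ _ (0 : R)).
- by move=> h k ch ck y; apply: (@continuousD _ _ _ h k y (ch y) (ck y)).
- move=> i _ y.
  by apply: (@continuousM _ _ (fun t => G t i 0) (fun t => G1 t i 0)); exact: coord.
Qed.

Let continuous_denergy : continuous denergy.
Proof.
move=> t; apply: (@continuousM _ _ (fun=> 2) (fun t => mxdot (dg t) (g t + ddg t))).
  exact: cst_continuous.
have cgd : continuous (fun s => g s + ddg s).
  by move=> s; apply: cvgD; [exact: cg|exact: cddg].
exact: continuous_mxdot2 cdg cgd t.
Qed.

Let circ_energy : circular energy.
Proof. by move=> a b h1 h2; rewrite /energy (circ_g h1 h2) (circ_dg h1 h2). Qed.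

Let circ_denergy : circular denergy.
Proof. by move=> a b h1 h2; rewrite /denergy (circ_g h1 h2) (circ_dg h1 h2) (circ_ddg h1 h2). Qed.

Let continuous_energy : continuous energy.
Proof. by move=> t; exact: is_derive_continuous (is_derive_energy t). Qed.

(** Where the energy is at least [s0] the coefficient [F (energy t)] is that of the
    equation; elsewhere it is replaced by the C1 extension of [F], which makes the
    divergence identity available on the whole circle. *)
Section Cutoff.
Variable s0 : R.
Hypothesis s0_gt0 : 0 < s0.

Let Ft := affine_below F F' s0.
Let Ft' s := F' (Num.max s s0).

Let dFt (s : R) : is_derive s 1 Ft (Ft' s).
Proof. by apply: is_derive_affine_below => r sr; apply: dF; exact: lt_le_trans sr. Qed.

Let cFt' : continuous Ft'.
Proof. by apply: continuous_comp_max => r sr; apply: cF'; exact: lt_le_trans sr. Qed.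

Let Q i t := Ft (energy t) * g t i 0.
Let Q' i t := Ft' (energy t) * denergy t * g t i 0 + Ft (energy t) * dg t i 0.
Let P i t := Ft (energy t) * dg t i 0.
Let P' i t := Ft' (energy t) * denergy t * dg t i 0 + Ft (energy t) * ddg t i 0.

Let C1_coef (G dG : R -> 'cV[R]_m) i : circular G -> circular dG ->
  (forall t : R, is_derive t 1 G (dG t)) -> continuous dG ->
  circular_C1 (fun t => Ft (energy t) * G t i 0)
    (fun t => Ft' (energy t) * denergy t * G t i 0 + Ft (energy t) * dG t i 0).
Proof.
move=> circG circdG hG cdG; split.
- by move=> a b h1 h2; rewrite (circ_energy h1 h2) (circG _ _ h1 h2).
- move=> a b h1 h2.
  by rewrite (circ_energy h1 h2) (circ_denergy h1 h2) (circG _ _ h1 h2) (circdG _ _ h1 h2).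
- move=> t; have /is_derive_mxP /(_ i 0) dGi := hG t.
  have dFe := is_derive1_comp (dFt (energy t)) (is_derive_energy t).
  apply: is_derive_eq; rewrite /GRing.scale /=; ring.
- have cFte : continuous (Ft \o energy).
    move=> t; apply: continuous_comp; first exact: continuous_energy.
    exact: is_derive_continuous (dFt _).
  have cFte' : continuous (Ft' \o energy).
    by move=> t; apply: continuous_comp; [exact: continuous_energy|exact: cFt'].
  have cG := cont hG.
  move=> t; apply: cvgD; apply: cvgM; last exact: coord.
  + by apply: cvgM; [exact: cFte'|exact: continuous_denergy].
  + exact: coord.
  + exact: cFte.
Qed.

(** The left-hand side of the equation of [g], with the extended coefficient. *)
Definition residual i t : R := Q i t + P' i t + (Lambda *m dg t) i 0.

Let circ_residual i : circular (residual i).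
Proof.
move=> a b h1 h2; rewrite /residual /Q /P' (circ_energy h1 h2) (circ_denergy h1 h2).
by rewrite (circ_g h1 h2) (circ_dg h1 h2) (circ_ddg h1 h2).
Qed.

Let continuous_residual i : continuous (residual i).
Proof.
have [_ _ dQ _] := C1_coef i circ_g circ_dg hdg cdg.
have [_ _ _ cP'] := C1_coef i circ_dg circ_ddg hddg cddg.
have cL : continuous (fun t => (Lambda *m dg t) i 0).
  have -> : (fun t => (Lambda *m dg t) i 0) = (fun t => mxdot ((row i Lambda)^T) (dg t)).
    by apply/funext => s; rewrite mxdot_col mxE; apply: eq_bigr => j _; rewrite !mxE.
  have crow : continuous (fun _ : R => (row i Lambda)^T) by move=> s; exact: cvg_cst.
  exact: continuous_mxdot2 crow cdg.
move=> t; apply: cvgD; first apply: cvgD.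
- exact: is_derive_continuous (dQ t).
- exact: cP'.
- exact: cL.
Qed.

Lemma weak_integrand_polar_form phi x : test_function phi -> x != 0 ->
  s0 <= energy (ang x) ->
  weak_integrand f Lambda u phi x =
  polar_form Q P P' phi x - \sum_i residual i (ang x) * ((rad x)^-1 * phi x i 0).
Proof.
move=> hphi x0 se.
have e0 : 0 < energy (ang x) by exact: lt_le_trans se.
have ng : enorm (grad u x) = Num.sqrt (energy (ang x)).
  apply/eqP; rewrite -(eqrXn2 (n := 2)) ?enorm_ge0 ?sqrtr_ge0 //.
  by rewrite (enorm_grad hu hdg x0) (sqr_sqrtr (ltW e0)).
rewrite (weak_integrand_homog (A := F (energy (ang x))) _ _ hu hdg x0); last first.
  by rewrite DgammaE ng ?hF //; apply: hf; rewrite sqrtr_gt0.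
have eF : Ft (energy (ang x)) = F (energy (ang x)) by rewrite /Ft /affine_below ltNge se.
rewrite /polar_form -sumrB; apply: eq_bigr => i _.
by rewrite /residual /Q /P eF; ring.
Qed.

Let weak_polar_off (phi : R * R -> 'cV[R]_m) (x : R * R) : test_function phi -> x != 0 -> (\forall y \near x, phi y = 0) ->
  weak_integrand f Lambda u phi x = 0 /\ polar_form Q P P' phi x = 0.
Proof.
move=> /test_C1[dphi _ _ _ _] x0 n.
have nz : \forall y \near x, phi y = cst 0 y by [].
have z := nbhs_singleton n.
have dz (v : R * R) : 'D_v phi x = 0 by rewrite (near_eq_derive v nz) derive_cst.
have zR : dR phi x = 0 by rewrite dR_test // !dz !scaler0 addr0.
have zT : dtau phi x = 0 by rewrite dtau_test // !dz !scaler0 subrr.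
split.
  rewrite /weak_integrand /grad zR zT z scaler0 /tensor !mul0mx addr0.
  by rewrite /mxdot !mulmx0 !mxtrace0 subrr.
by rewrite /polar_form big1 // => i _; rewrite zR zT z !mxE !mulr0 !addr0.
Qed.

Let lt_le2 (a b t : R) : a < t < b -> a <= t <= b.
Proof. by move=> /andP[h1 h2]; rewrite !ltW. Qed.

(** Otherwise the residual keeps a sign near the point of radius 1/2 and angle
    [th]. Test with a bump supported there: since the polar form integrates to
    zero, so does residual times bump over [rad], which is positive on a box. *)
Lemma residual_eq0 i th : s0 < energy th -> residual i th = 0.
Proof.
move=> sth; apply/eqP; apply: contraT => E0; exfalso; set e0 := residual i th in E0.
pose x0 : R * R := (2^-1 * cos th, 2^-1 * sin th).
have h0 : 0 < 2^-1 :> R by rewrite invr_gt0.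
have r0 : rad x0 = 2^-1 by rewrite rad_polar // ltW.
have x0n0 : x0 != 0 by rewrite -rad_gt0 r0.
have a0 (W : R -> R) : circular W -> W (ang x0) = W th by move=> cW; exact: circular_ang.
(* a neighborhood of a point in the direction th where everything has a sign *)
have [e /= e_gt0 good] : exists2 e : R, 0 < e & forall x : R * R,
    `|x0.1 - x.1| < e -> `|x0.2 - x.2| < e ->
    [/\ x != 0, rad x < 1, s0 <= energy (ang x) & 0 < e0 * residual i (ang x)].
  have nr : \forall x \near x0, rad x \in `]0, 1[.
    have c : {for x0, continuous (@rad R)} by exact: rad_continuous.
    apply: (c [set r | r \in `]0, 1[]); apply: near_in_itvoo.
    by rewrite in_itv /= r0 h0 /=; lra.
  have ne : \forall x \near x0, s0 < energy (ang x).
    have c := continuous_circular_ang circ_energy continuous_energy x0n0.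
    by apply: (c [set r | s0 < r]); apply: lt_nbhsr; rewrite /= (a0 energy).
  have nE : \forall x \near x0, 0 < e0 * residual i (ang x).
    have c : {for x0, continuous (fun x => e0 * (residual i \o ang) x)}.
      apply: (@continuousM _ _ (fun=> e0) (residual i \o ang)); first exact: cst_continuous.
      exact: continuous_circular_ang (@circ_residual i) (@continuous_residual i) x0n0.
    apply: (c [set r | 0 < r]); apply: lt_nbhsr; rewrite /= (a0 (residual i)) // -/e0 -expr2.
    by rewrite lt_def sqr_ge0 sqrf_eq0 E0.
  have /nbhs_ballP[e /= e_gt0 he] : \forall x \near x0, [/\ rad x \in `]0, 1[, s0 < energy (ang x) &
      0 < e0 * residual i (ang x)].
    by near=> x; split; near: x.
  exists e => // x h1 h2; have [/andP[x1 x2] x3 x4] := he x (conj h1 h2).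
  by split => //; [rewrite -rad_gt0|exact: ltW].
pose d := e / 2; have d0 : 0 < d by rewrite divr_gt0.
have de : d < e by rewrite /d; lra.
pose a1 := x0.1 - d; pose b1 := x0.1 + d; pose a2 := x0.2 - d; pose b2 := x0.2 + d.
have goodK (x : R * R) : a1 <= x.1 <= b1 -> a2 <= x.2 <= b2 ->
    [/\ x != 0, rad x < 1, s0 <= energy (ang x) & 0 < e0 * residual i (ang x)].
  rewrite /a1 /b1 /a2 /b2 => /andP[h1 h2] /andP[h3 h4].
  by apply: good; rewrite ltr_norml; apply/andP; move: h1 h2 h3 h4 => /= h1 h2 h3 h4; split; lra.
pose phi : R * R -> 'cV[R]_m := bump2 a1 b1 a2 b2 (delta_mx i 0).
have hphi : test_function phi.
  by apply: test_function_bump2 => x h1 h2; have [] := goodK x h1 h2.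
pose bb (x : R * R) := bump a1 b1 x.1 * bump a2 b2 x.2.
have bb_off (x : R * R) : ~~ ((a1 < x.1 < b1) && (a2 < x.2 < b2)) -> bb x = 0.
  by rewrite negb_and /bb => /orP[/bump_off ->|/bump_off ->]; rewrite ?mul0r ?mulr0.
pose K x := e0 * residual i (ang x) * ((rad x)^-1 * bb x).
have eK x : K x = e0 * (polar_form Q P P' phi x - weak_integrand f Lambda u phi x).
  rewrite /K; have [->|xn0] := eqVneq x 0.
    by rewrite polar_form0 weak_integrand0 rad0 invr0 mul0r mulr0 subrr mulr0.
  have [/andP[h1 h2]|xK] := boolP ((a1 <= x.1 <= b1) && (a2 <= x.2 <= b2)).
    have [_ _ se _] := goodK x h1 h2.
    rewrite weak_integrand_polar_form // opprB addrC subrK -mulrA; congr (_ * _).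
    rewrite (bigD1 i) //= big1 ?addr0; first by rewrite /phi /bump2 !mxE !eqxx mulr1.
    by move=> j ji; rewrite /phi /bump2 !mxE (negPf ji) !mulr0.
  have n : \forall y \near x, phi y = 0.
    have oK : open (~` (`[a1, b1]%classic `*` `[a2, b2]%classic : set (R * R))).
      apply: closed_openC; apply: compact_closed; first exact: norm_hausdorff.
      by apply: compact_setX; exact: segment_compact.
    have xC : (~` (`[a1, b1]%classic `*` `[a2, b2]%classic : set (R * R))) x.
      move=> [h1 h2]; move: xK h1 h2 => /negP; rewrite /= !in_itv /= => xK h1 h2.
      by apply: xK; rewrite h1.
    have := open_nbhs_nbhs (conj oK xC); apply: filterS => y yK.
    rewrite /phi /bump2 -/(bb y) bb_off ?scale0r //; apply/negP => /andP[/andP[y1 y2] /andP[y3 y4]].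
    by apply: yK; split; rewrite /= in_itv /= !ltW.
  have [-> ->] := weak_polar_off hphi xn0 n.
  rewrite bb_off; first by rewrite subrr !mulr0.
  apply: contra xK => /andP[/andP[y1 y2] /andP[y3 y4]].
  by rewrite !ltW.
have K0 x : 0 <= K x.
  have [/andP[h1 h2]|/bb_off h] := boolP ((a1 < x.1 < b1) && (a2 < x.2 < b2)); last first.
    by rewrite /K h !mulr0.
  have [_ _ _ p] := goodK x (lt_le2 h1) (lt_le2 h2).
  rewrite /K mulr_ge0 ?(ltW p) // mulr_ge0 ?invr_ge0 ?rad_ge0 //.
  by rewrite mulr_ge0 // ltW // bump_gt0.
have [iw zw] := hsol hphi.
have [ip zp] := polar_form_integral
  (fun i => C1_coef i circ_g circ_dg hdg cdg)
  (fun i => C1_coef i circ_dg circ_ddg hddg cddg) hphi.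
have zK : (\int[mu2]_(x in @disk R) `|(K x)%:E| = 0)%E.
  under eq_integral => x _ do rewrite gee0_abs ?lee_fin // eK EFinM EFinB.
  rewrite (integralZl measurable_disk (integrableB measurable_disk ip iw)).
  by rewrite (integralB_EFin measurable_disk ip iw) zw zp sube0 mule0.
have mK : measurable_fun (@disk R : set T2) (EFin \o K).
  have -> : EFin \o K = (fun x => e0%:E * ((polar_form Q P P' phi x)%:E -
      (weak_integrand f Lambda u phi x)%:E))%E.
    by apply/funext => x; rewrite /= eK EFinM EFinB.
  exact: measurable_int (integrableZl measurable_disk e0 (integrableB measurable_disk ip iw)).
have [N [mN N0 hN]] := (ae_eq_integral_abs mu2 measurable_disk mK).1 zK.
pose B : set T2 := `]a1, b1[%classic `*` `]a2, b2[%classic.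
have BN : B `<=` N.
  move=> x [h1 h2]; apply: hN => /= h.
  have [_ xd _ p] := goodK x (lt_le2 h1) (lt_le2 h2).
  have xn0 : x != 0 by have [] := goodK x (lt_le2 h1) (lt_le2 h2).
  have : K x = 0 by have := h xd => -[].
  apply/eqP; rewrite gt_eqF // /K mulr_gt0 // mulr_gt0 ?invr_gt0 ?rad_gt0 //.
  by rewrite mulr_gt0 // bump_gt0.
have mB : measurable B by apply: measurableX; exact: measurable_itv.
have : mu2 B = 0%E by apply: subset_measure0 BN N0.
have -> : mu2 B = (lebesgue_measure (`]a1, b1[%classic : set R) *
   lebesgue_measure (`]a2, b2[%classic : set R))%E by apply: product_measure1E.
rewrite !lebesgue_measure_itv /= !lte_fin /a1 /b1 /a2 /b2 !ifT; [|lra|lra].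
rewrite -!EFinB -EFinM => -[] /eqP; apply/negP; rewrite gt_eqF // mulr_gt0 //; lra.
Unshelve. all: by end_near. Qed.

End Cutoff.
End Local.

(** * The conservation law *)

Section PartB.
Context {R : realType}.
Variables (m : nat) (Lambda : 'M[R]_m) (f : R -> R).
Hypothesis hanti : Lambda^T = - Lambda.
Hypothesis hC2 : C2_on [set t : R | 0 < t] f.
Hypothesis hconvex : forall t, 0 < t -> 0 < derive1n 2 f t.
Hypothesis h0 : exists2 l : R, derive1 f x @[x --> 0^'+] --> l & 0 <= l.

Let f1 := derive1 f.
Let f2 := derive1n 2 f.

Let df1 (t : R) : 0 < t -> is_derive t 1 f1 (f2 t).
Proof.
move=> t0; have [_ d _] := hC2 t0.
by rewrite /f2 derive1nS derive1n1 derive1E; exact: derivableP.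
Qed.

Let f1_continuous (t : R) : 0 < t -> {for t, continuous f1}.
Proof. by move=> /df1; exact: is_derive_continuous. Qed.

(** [f'] increases strictly from a nonnegative limit at [0]. *)
Lemma derive1_gt0 t : 0 < t -> 0 < f1 t.
Proof.
move=> t0.
have incr (a b : R) : 0 < a -> a < b -> f1 a < f1 b.
  move=> a0 ab.
  have d (x : R) : x \in `]a, b[ -> is_derive x 1 f1 (f2 x).
    by rewrite in_itv /= => /andP[ax _]; apply: df1; exact: lt_trans ax.
  have c1 : {within `[a, b], continuous f1}.
    apply: continuous_in_subspaceT => x; rewrite inE /= in_itv /= => /andP[ax _].
    by apply: f1_continuous; exact: lt_le_trans ax.
  have [c] := MVT ab d c1.
  rewrite in_itv /= => /andP[ac _] e.
  by rewrite -subr_gt0 e mulr_gt0 ?subr_gt0 // hconvex // (lt_trans a0).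
have [l hl l0] := h0; have t2 : 0 < t / 2 by rewrite divr_gt0.
have tt : t / 2 < t by lra.
apply: le_lt_trans (incr _ _ t2 tt); apply: le_trans l0 _.
rewrite leNgt; apply/negP => h.
have n1 : \forall x \near 0^'+, f1 (t / 2) < f1 x by exact: (cvgr_gt _ hl).
have [x [x1 x0 x2]] : exists x, [/\ f1 (t / 2) < f1 x, 0 < x & x < t / 2].
  by apply: (@filter_ex _ (0 : R)^'+); near=> x; split; near: x => //; [exact: nbhs_right_gt|exact: nbhs_right_lt].
by have := lt_trans x1 (incr _ _ x0 x2); rewrite ltxx.
Unshelve. all: by end_near. Qed.

(* [F] gives [f'(|grad u|) / |grad u|] in terms of [|grad u|^2], which is smoother than the norm *)
Let F (s : R) := f1 (Num.sqrt s) / Num.sqrt s.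
Let F' (s : R) := (f2 (Num.sqrt s) * Num.sqrt s - f1 (Num.sqrt s)) / (2 * Num.sqrt s ^+ 3).

Let dF (s : R) : 0 < s -> is_derive s 1 F (F' s).
Proof.
move=> s0; have q0 : 0 < Num.sqrt s by rewrite sqrtr_gt0.
have qn0 : Num.sqrt s != 0 by rewrite gt_eqF.
have dq := is_derive1_sqrt s0.
have dfq := is_derive1_comp (df1 q0) dq.
have dv := is_deriveV qn0 dq.
apply: is_derive_eq; rewrite /F' /GRing.scale /=; field.
by rewrite qn0.
Qed.

Let cF' (s : R) : 0 < s -> {for s, continuous F'}.
Proof.
move=> s0; have q0 : 0 < Num.sqrt s by rewrite sqrtr_gt0.
have cq : {for s, continuous (@Num.sqrt R)} by exact: sqrt_continuous.
have [_ _ c2] := hC2 q0.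
have cf2 : {for s, continuous (fun s => f2 (Num.sqrt s))} by exact: continuous_comp cq c2.
have cf1 : {for s, continuous (fun s => f1 (Num.sqrt s))}.
  exact: continuous_comp cq (f1_continuous q0).
apply: cvgM.
  by apply: cvgB => //; apply: cvgM.
apply: cvgV; first by rewrite mulf_neq0 // expf_neq0 // gt_eqF.
apply: cvgM; first exact: cvg_cst.
exact: continuous_comp cq (@exprn_continuous _ 3 _).
Qed.

(** Let [H = |g|^2 + |g'|^2]. Where [H > 0], the scalar product of the equation with
    [g'] kills [Lambda g'] and, with [t = sqrt H], leaves
    [H' * (f'(t) |g|^2 + t f''(t) |g'|^2) / (2 t^3) = 0], whose second factor is
    positive. Where [H = 0], [g' = 0] and [H' = 2 g' . (g + g'')] vanishes too. So
    [H] is constant. *)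
Lemma conservation (u : R * R -> 'cV[R]_m) :
  one_homogeneous_solution f Lambda u ->
  C2_on [set: R] (profile u) ->
  exists c : R,
    conservation_law (profile u) c /\
    (forall theta : R, theta \in `[0, 2 * pi] ->
      (derive1 f c / c) *: (derive1n 2 (profile u) theta + profile u theta)
      + Lambda *m derive1 (profile u) theta = 0).
Proof.
move=> [hu hsol] hg.
set g := profile u in hg *; pose dg := derive1 g; pose ddg := derive1n 2 g.
have hdg (t : R) : is_derive t 1 g (dg t).
  by have [d _ _] := hg t I; rewrite /dg derive1E; exact: derivableP.
have hddg (t : R) : is_derive t 1 dg (ddg t).
  by have [_ d _] := hg t I; rewrite /ddg derive1nS derive1n1 derive1E; exact: derivableP.
have cddg : continuous ddg by move=> t; have [] := hg t I.
have hf t : 0 < t -> derivable f t 1 by move=> t0; have [] := hC2 t0.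
pose H := energy u dg; pose H' := denergy u dg ddg.
have dH (t : R) : is_derive t 1 H (H' t) by exact: is_derive_energy.
have H0 t : 0 <= H t by rewrite addr_ge0 // sqr_ge0.
have ode th : 0 < H th ->
    F (H th) *: (ddg th + g th) + (F' (H th) * H' th) *: dg th + Lambda *m dg th = 0.
  move=> Hth; apply/matrixP => i j; rewrite (ord1 j) [RHS]mxE.
  have s0 : 0 < H th / 2 by rewrite divr_gt0.
  have sH : H th / 2 < H th by lra.
  have := residual_eq0 hu hsol hdg hddg cddg hf (fun s _ => erefl) dF cF' s0 i sH.
  rewrite /residual /affine_below (ltNge (energy _ _ _)) (ltW sH) /=.
  rewrite (max_idPl (ltW sH)) => e; rewrite -[RHS]e !mxE -/g.
  have -> : F (H th) = derive1 f (Num.sqrt (energy u dg th)) / Num.sqrt (energy u dg th) by [].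
  by rewrite -/(H' th); ring.
have H'0 th : H' th = 0.
  have [e|e] := eqVneq (H th) 0.
    have : dg th = 0.
      move: e; rewrite /H /energy => /eqP; rewrite paddr_eq0 ?sqr_ge0 // => /andP[_].
      by rewrite sqrf_eq0 => /eqP h; apply/eqP; apply: contraT; rewrite -enorm_gt0 h ltxx.
    by rewrite /H' /denergy => ->; rewrite /mxdot trmx0 mul0mx mxtrace0 mulr0.
  have Hp : 0 < H th by rewrite lt_def e H0.
  have := congr1 (mxdot (dg th)) (ode th Hp).
  rewrite !(mxdotDr, mxdotZr) (mxdot_antisym0 hanti) addr0 [mxdot (dg th) 0]/mxdot mulmx0 mxtrace0.
  have -> : mxdot (dg th) (ddg th) + mxdot (dg th) (g th) = H' th / 2.
    by rewrite /H' /denergy mxdotDr [_ + mxdot _ (ddg _)]addrC mulrC mulKf.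
  set t := Num.sqrt (H th); have t0 : 0 < t by rewrite sqrtr_gt0.
  rewrite (_ : _ + _ = H' th * (F (H th) / 2 + F' (H th) * mxdot (dg th) (dg th))); last by ring.
  move/eqP; rewrite mulf_eq0 => /orP[/eqP //|/eqP h]; exfalso.
  have t2 : t ^+ 2 = enorm (g th) ^+ 2 + enorm (dg th) ^+ 2 by rewrite sqr_sqrtr // H0.
  have : F (H th) / 2 + F' (H th) * mxdot (dg th) (dg th) =
     (f1 t * enorm (g th) ^+ 2 + f2 t * t * enorm (dg th) ^+ 2) / (2 * t ^+ 3).
    rewrite -enorm_sqr (_ : enorm (g th) ^+ 2 = t ^+ 2 - enorm (dg th) ^+ 2); last by rewrite t2 addrK.
    by rewrite /F /F' -/t; field; rewrite gt_eqF.
  have p1 : 0 < f1 t := derive1_gt0 t0.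
  have p2 : 0 < f2 t * t by rewrite mulr_gt0 // hconvex.
  have g0 := sqr_ge0 (enorm (g th)); have d0 := sqr_ge0 (enorm (dg th)).
  have p3 : 0 < enorm (g th) ^+ 2 + enorm (dg th) ^+ 2 by rewrite -t2 exprn_gt0.
  rewrite h => /esym /eqP; rewrite gt_eqF // divr_gt0 ?mulr_gt0 ?exprn_gt0 //.
  have [gz|gn] := eqVneq (enorm (g th) ^+ 2) 0.
    by move: p3; rewrite gz mulr0 !add0r => p3; rewrite mulr_gt0.
  by apply: ltr_wpDr; [rewrite mulr_ge0 // ltW|rewrite mulr_gt0 // lt_def gn].
pose c := Num.sqrt (H 0).
have c0 : 0 <= c by exact: sqrtr_ge0.
have dH0 (t : R) : is_derive t 1 H 0 by rewrite -(H'0 t).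
have Hc th : H th = c ^+ 2.
  rewrite /c (sqr_sqrtr (H0 0)); exact: (is_derive_0_is_cst th 0 dH0).
exists c; split.
  by split; [exact: c0|move=> th; case: (hdg th)|exact: Hc].
move=> th _; rewrite -/(ddg th) -/(dg th).
have [cz|cn] := eqVneq c 0.
  have gz s : g s = 0 /\ dg s = 0.
    have := Hc s; rewrite cz expr0n /= /H /energy => /eqP.
    rewrite paddr_eq0 ?sqr_ge0 // !sqrf_eq0 => /andP[/eqP h1 /eqP h2].
    by split; apply/eqP; apply: contraT; rewrite -enorm_gt0 ?h1 ?h2 ltxx.
  by rewrite cz invr0 mulr0 scale0r (gz th).2 mulmx0 addr0.
have cp : 0 < c by rewrite lt_def cn.
have Hp : 0 < H th by rewrite Hc exprn_gt0.
have eF : F (H th) = derive1 f c / c by rewrite /F Hc sqrtr_sqr ger0_norm.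
by have := ode th Hp; rewrite eF H'0 mulr0 scale0r addr0.
Qed.

End PartB.

(** * One-homogeneous solutions of the weak equation *)

Theorem proposition2p1 (R : realType) (m : nat) (hm : (2 <= m)%N)
    (Lambda : 'M[R]_m) (hanti : Lambda^T = - Lambda) (hLambda : Lambda != 0)
    (f : R -> R) (hf : forall t, 0 < t -> derivable f t 1) :
  (* (a)(i) *)
  (odd m \/ (~~ odd m /\ exists2 v : 'cV[R]_m, v != 0 & Lambda *m v = 0) ->
    exists u : R * R -> 'cV[R]_m,
      [/\ one_homogeneous_solution f Lambda u,
          exists c : R, conservation_law (profile u) c,
          linear u &
          exists x, u x != 0]) /\
  (* (a)(ii) *)
  (forall k : nat, (2 <= k)%N ->
    (exists t : R,
      let s := (((k%:R ^+ 2 - 1) * derive1 f t) / (k%:R * t)) ^+ 2 in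
      [/\ 0 < t, s != 0 & eigenvalue (- (Lambda *m Lambda)) s]) ->
    exists u : R * R -> 'cV[R]_m,
      [/\ one_homogeneous_solution f Lambda u,
          exists c : R, conservation_law (profile u) c,
          ~ linear u,
          homeomorphic (@disk R) (u @` disk) &
          covered_times u k]) /\
  (* (b) *)
  (C2_on [set t : R | 0 < t] f ->
    (forall t, 0 < t -> 0 < derive1n 2 f t) ->
    (exists2 l : R, derive1 f x @[x --> 0^'+] --> l & 0 <= l) ->
    forall u : R * R -> 'cV[R]_m,
      one_homogeneous_solution f Lambda u ->
      C2_on [set: R] (profile u) ->
      exists c : R,
        conservation_law (profile u) c /\
        (forall theta : R, theta \in `[0, 2 * pi] ->
          (derive1 f c / c) *: (derive1n 2 (profile u) theta + profile u theta)
          + Lambda *m derive1 (profile u) theta = 0)).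
Proof.
split; [|split].
- move=> [om|[_ [v v0 Lv]]].
    have [v v0 Lv] := antisym_odd_kernel hanti om.
    apply: linear_solution v0 Lv; exact: hf.
  apply: linear_solution v0 Lv; exact: hf.
- move=> k k2 [t /= [t0 s0 hs]].
  apply: (winding_solution_exists hanti _ k2 t0 s0 hs); exact: hf.
- move=> hC2 hconvex h0 u hu hg.
  by have := conservation hanti hC2 hconvex h0 hu hg.
Qed.
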